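(* Let $\mathbb{SU}=\prod_{n=1}^\infty SU(n)$. For a comeager set of $G\in\mathcal{S}(\mathbb{SU})$, $G$ contains a non-identity element of finite order and an element of infinite order (i.e. $G$ is neither torsion-free nor a torsion group).
   Context: $\mathbb{SU}$ carries the product topology, metrized by $d(x,y)=\sum_n 2^{-n}d_n(x(n),y(n))$ where $d_n\le 1$ is a biinvariant metric on $SU(n)$. $\mathcal{S}(\mathbb{SU})$ is the set of nonempty compact subgroups of $\mathbb{SU}$ with the Hausdorff metric induced by $d$. *)

(* Defs.v *)
From HB Require Import structures.
From mathcomp Require Import all_boot all_order all_algebra.
From mathcomp Require Import complex.
From mathcomp Require Import all_classical all_reals all_analysis.
From mathcomp Require Import borel_hierarchy.

Set Implicit Arguments.
Unset Strict Implicit.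
Unset Printing Implicit Defensive.

Import Order.TTheory GRing.Theory Num.Theory.
Import numFieldNormedType.Exports.

Local Open Scope classical_set_scope.
Local Open Scope ring_scope.
Local Open Scope sesquilinear_scope.

(* The norm topology; the library only declares it for variable field types. *)
HB.instance Definition _ (R : realType) :=
  PseudoPointedMetric.copy R[i] (R[i])^o.

Record SU (R : realType) (n : nat) := MkSU {
  su_mx :> 'M[R[i]]_n;
  su_mxP : (su_mx \is unitarymx) && (\det su_mx == 1) }.

HB.instance Definition _ (R : realType) n := [isSub for @su_mx R n].
HB.instance Definition _ (R : realType) n := [Choice of SU R n by <:].

HB.instance Definition _ (R : realType) n :=
  Uniform.copy (SU R n) (initial_topology (@su_mx R n)).

Section SU_group.
Variables (R : realType) (n : nat).
Implicit Types A B C : SU R n.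

Fact su_one_proof :
  ((1%:M : 'M[R[i]]_n) \is unitarymx) && (\det (1%:M : 'M[R[i]]_n) == 1).
Proof.
by rewrite det1 eqxx andbT; apply/unitarymxP; rewrite trmx1 map_mx1 mulmx1.
Qed.

Fact su_mul_proof A B : ((A *m B) \is unitarymx) && (\det (A *m B) == 1).
Proof.
case/andP: (su_mxP A) => uA /eqP dA; case/andP: (su_mxP B) => uB /eqP dB.
by rewrite mul_unitarymx// det_mulmx dA dB mulr1 eqxx.
Qed.

Fact su_inv_proof A :
  ((A ^t* : 'M[R[i]]_n) \is unitarymx) && (\det (A ^t* : 'M[R[i]]_n) == 1).
Proof.
case/andP: (su_mxP A) => uA /eqP dA.
by rewrite trmxC_unitary uA det_map_mx det_tr dA rmorph1 eqxx.
Qed.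

Definition su_one : SU R n := MkSU su_one_proof.
Definition su_mul A B : SU R n := MkSU (su_mul_proof A B).
Definition su_inv A : SU R n := MkSU (su_inv_proof A).

Fact su_mulA : associative su_mul.
Proof. by move=> A B C; apply/val_inj/mulmxA. Qed.
Fact su_mul1 : left_id su_one su_mul.
Proof. by move=> A; apply/val_inj/mul1mx. Qed.
Fact su_mulr1 : right_id su_one su_mul.
Proof. by move=> A; apply/val_inj/mulmx1. Qed.
Fact su_mulVr : right_inverse su_one su_inv su_mul.
Proof.
by move=> A; apply/val_inj/unitarymxP; case/andP: (su_mxP A).
Qed.
Fact su_mulV : left_inverse su_one su_inv su_mul.
Proof. by move=> A; apply/val_inj/mulmx1C/(congr1 val (su_mulVr A)). Qed.

HB.instance Definition _ :=
  isGroup.Build (SU R n) su_mulA su_mul1 su_mulr1 su_mulV su_mulVr.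

End SU_group.

(* The factor of index [n : nat] is SU(n+1). *)
Definition prodSU (R : realType) : Type := forall n : nat, SU R n.+1.

HB.instance Definition _ (R : realType) :=
  Uniform.copy (prodSU R) (prod_topology (fun n : nat => SU R n.+1)).

Section prodSU_group.
Variable R : realType.
Implicit Types x y z : prodSU R.

Definition psu_one : prodSU R := fun n => 1%g.
Definition psu_mul x y : prodSU R := fun n => (x n * y n)%g.
Definition psu_inv x : prodSU R := fun n => ((x n)^-1)%g.

Fact psu_mulA : associative psu_mul.
Proof. by move=> x y z; apply: functional_extensionality_dep => n; apply: mulgA. Qed.
Fact psu_mul1 : left_id psu_one psu_mul.
Proof. by move=> x; apply: functional_extensionality_dep => n; apply: mul1g. Qed.
Fact psu_mulr1 : right_id psu_one psu_mul.
Proof. by move=> x; apply: functional_extensionality_dep => n; apply: mulg1. Qed.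
Fact psu_mulV : left_inverse psu_one psu_inv psu_mul.
Proof. by move=> x; apply: functional_extensionality_dep => n; apply: mulVg. Qed.
Fact psu_mulVr : right_inverse psu_one psu_inv psu_mul.
Proof. by move=> x; apply: functional_extensionality_dep => n; apply: mulgV. Qed.

HB.instance Definition _ :=
  isGroup.Build (prodSU R) psu_mulA psu_mul1 psu_mulr1 psu_mulV psu_mulVr.

End prodSU_group.

Record biinvariant_metric (R : realType) (n : nat) := BiinvariantMetric {
  bdist :> SU R n -> SU R n -> R;
  bdistxx : forall x, bdist x x = 0;
  bdist_positivity : forall x y, bdist x y = 0 -> x = y;
  bdist_sym : forall x y, bdist x y = bdist y x;
  bdist_triangle : forall y x z, bdist x z <= bdist x y + bdist y z;
  (* [bdist] induces the topology of SU(n) *)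
  bdist_nbhs : forall x (A : set (SU R n)),
    nbhs x A <-> exists2 e, 0 < e & [set y | bdist x y < e] `<=` A;
  bdist_mull : forall g x y, bdist (g * x)%g (g * y)%g = bdist x y;
  bdist_mulr : forall g x y, bdist (x * g)%g (y * g)%g = bdist x y;
  bdist_le1 : forall x y, bdist x y <= 1 }.

Definition prod_dist (R : realType) (d : forall n, biinvariant_metric R n.+1)
    (x y : prodSU R) : R :=
  limn (series (fun n => 2 ^- n.+1 * d n (x n) (y n))).

Section hausdorff_distance.
Variables (R : realType) (X : Type) (rho : X -> X -> R).

Definition point_set_dist (x : X) (B : set X) : R := inf [set rho x b | b in B].

Definition excess (A B : set X) : R := sup [set point_set_dist a B | a in A].

Definition hausdorff_dist (A B : set X) : R :=
  Num.max (excess A B) (excess B A).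

End hausdorff_distance.

(* Nonemptiness is part of [group_closed]: the identity is a member. *)
Record compact_subgroup (R : realType) := CompactSubgroup {
  csg_set :> set (prodSU R);
  csg_compact : compact csg_set;
  csg_group : group_closed (mem csg_set) }.

(* The dependency on [d] selects the Hausdorff metric put on the subgroups. *)
Definition subgroup_space (R : realType)
  (d : forall n, biinvariant_metric R n.+1) : Type := compact_subgroup R.

HB.instance Definition _ (R : realType)
  (d : forall n, biinvariant_metric R n.+1) := gen_eqMixin (subgroup_space d).
HB.instance Definition _ (R : realType)
  (d : forall n, biinvariant_metric R n.+1) :=
  gen_choiceMixin (subgroup_space d).

Section hausdorff_dist_theory.
Variables (R : realType) (X : Type) (rho : X -> X -> R).
Hypothesis rho_ge0 : forall x y, 0 <= rho x y.
Hypothesis rho_le1 : forall x y, rho x y <= 1.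
Hypothesis rhoxx : forall x, rho x x = 0.
Hypothesis rho_triangle : forall y x z, rho x z <= rho x y + rho y z.

Let psd := point_set_dist rho.

Let psd_has_inf x (B : set X) : B !=set0 -> has_inf [set rho x b | b in B].
Proof.
move=> [b Bb]; split; first by exists (rho x b), b.
by exists 0 => _ [c _ <-].
Qed.

Lemma point_set_dist_le x (B : set X) b : B b -> psd x B <= rho x b.
Proof.
move=> Bb; apply: (ge_inf (psd_has_inf x _).2); last by exists b.
by exists b.
Qed.

Lemma le_point_set_dist x (B : set X) r :
  B !=set0 -> (forall b, B b -> r <= rho x b) -> r <= psd x B.
Proof.
move=> B0 h; apply: lb_le_inf; first exact: (psd_has_inf x B0).1.
by move=> _ [b Bb <-]; exact: h.
Qed.

Lemma excess_ge (A B : set X) a : B !=set0 -> A a -> psd a B <= excess rho A B.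
Proof.
move=> [b Bb] Aa; apply: ub_le_sup; last by exists a.
exists 1 => _ [c _ <-]; exact: le_trans (point_set_dist_le c Bb) (rho_le1 _ _).
Qed.

Lemma excess_le (A B : set X) r :
  A !=set0 -> (forall a, A a -> psd a B <= r) -> excess rho A B <= r.
Proof.
move=> [a Aa] h; apply: ge_sup; first by exists (psd a B), a.
by move=> _ [c Ac <-]; exact: h.
Qed.

Lemma excess_ge0 (A B : set X) : A !=set0 -> B !=set0 -> 0 <= excess rho A B.
Proof.
move=> [a Aa] B0; apply: le_trans (excess_ge B0 Aa).
by apply: le_point_set_dist.
Qed.

Lemma excess_triangle (B A C : set X) : A !=set0 -> B !=set0 -> C !=set0 ->
  excess rho A C <= excess rho A B + excess rho B C.
Proof.
move=> A0 B0 C0; apply: excess_le => // a Aa.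
rewrite -lerBlDr (le_trans _ (excess_ge B0 Aa))//.
apply: le_point_set_dist => // b Bb; rewrite lerBlDr.
rewrite (le_trans _ (lerD (lexx _) (excess_ge C0 Bb)))// -lerBlDl.
apply: le_point_set_dist => // c Cc; rewrite lerBlDl.
exact: le_trans (point_set_dist_le a Cc) (rho_triangle _ _ _).
Qed.

Lemma hausdorff_distxx (A : set X) : A !=set0 -> hausdorff_dist rho A A = 0.
Proof.
move=> A0; rewrite /hausdorff_dist maxxx; apply/eqP.
rewrite eq_le excess_ge0// andbT; apply: excess_le => // a Aa.
by rewrite -(rhoxx a); exact: point_set_dist_le.
Qed.

Lemma hausdorff_dist_triangle (B A C : set X) :
  A !=set0 -> B !=set0 -> C !=set0 ->
  hausdorff_dist rho A C <= hausdorff_dist rho A B + hausdorff_dist rho B C.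
Proof.
move=> A0 B0 C0; rewrite ge_max; apply/andP; split.
  apply: le_trans (excess_triangle A0 B0 C0) _.
  by apply: lerD; rewrite /hausdorff_dist le_max lexx.
apply: le_trans (excess_triangle C0 B0 A0) _.
by rewrite addrC; apply: lerD; rewrite /hausdorff_dist le_max lexx orbT.
Qed.

Lemma excess0 (A B : set X) a e : B !=set0 -> excess rho A B <= 0 -> A a ->
  0 < e -> exists2 b, B b & rho a b < e.
Proof.
move=> B0 AB Aa e0.
have [_ [b Bb <-] be] := inf_adherent e0 (psd_has_inf a B0).
exists b => //; apply: lt_le_trans be _.
by rewrite -[leRHS]add0r lerD2r; exact: le_trans (excess_ge B0 Aa) AB.
Qed.

End hausdorff_dist_theory.

Section prod_dist_theory.
Variables (R : realType) (d : forall n, biinvariant_metric R n.+1).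
Implicit Types x y z : prodSU R.

Lemma bdist_ge0 n (r : biinvariant_metric R n) (x y : SU R n) : 0 <= r x y.
Proof.
rewrite -(@pmulrn_lge0 _ _ 2)// -(bdistxx r x).
by rewrite (le_trans (bdist_triangle r y _ _))// (bdist_sym r y) -mulr2n.
Qed.

Let u x y : R^nat := fun n => 2 ^- n.+1 * d n (x n) (y n).

Let u_ge0 x y n : 0 <= u x y n.
Proof. by rewrite mulr_ge0// ?bdist_ge0// invr_ge0 exprn_ge0. Qed.

Let half_ge0 n : 0 <= (2 ^- n.+1 : R).
Proof. by rewrite invr_ge0 exprn_ge0. Qed.

Let half_cvg : series (fun n => 2 ^- n.+1 : R) @ \oo --> (1 : R).
Proof.
have -> : (fun n => 2 ^- n.+1 : R) = (fun n => 1 / (2 ^ (n + 1))%:R).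
  by apply/funext => n; rewrite div1r addn1 natrX.
by have := @cvg_geometric_series_half R 1 0; rewrite expr0 divr1.
Qed.

Let u_le x y n : u x y n <= 2 ^- n.+1.
Proof. by rewrite ler_piMr ?bdist_le1. Qed.

Lemma is_cvg_prod_dist x y :
  cvgn (series (fun n => 2 ^- n.+1 * d n (x n) (y n))).
Proof.
apply: (series_le_cvg (u_ge0 x y) half_ge0 (u_le x y)).
by apply/cvg_ex; exists 1.
Qed.

Lemma prod_dist_ge x y n : u x y n <= prod_dist d x y.
Proof.
have nd : nondecreasing_seq (series (u x y)).
  by apply/nondecreasing_seqP => k; rewrite seriesSr lerDl.
have := nondecreasing_cvgn_le nd (@is_cvg_prod_dist x y) n.+1.
apply: le_trans.
by rewrite seriesSr lerDr; apply: sumr_ge0.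
Qed.

Lemma prod_dist_ge0 x y : 0 <= prod_dist d x y.
Proof. exact: le_trans (u_ge0 x y 0) (prod_dist_ge x y 0). Qed.

Lemma prod_dist_le1 x y : prod_dist d x y <= 1.
Proof.
rewrite -(cvg_lim _ half_cvg)//; apply: ler_lim; first exact: is_cvg_prod_dist.
  by apply/cvg_ex; exists 1.
by near=> n; apply: ler_sum => i _; exact: u_le.
Unshelve. all: by end_near. Qed.

Lemma prod_distxx x : prod_dist d x x = 0.
Proof.
rewrite /prod_dist (_ : (fun _ => _) = fun=> 0).
  rewrite (_ : series _ = fun=> 0) ?lim_cst//.
  by apply/funext => n; rewrite /series/= big1.
by apply/funext => n; rewrite bdistxx mulr0.
Qed.

Lemma prod_dist_sym x y : prod_dist d x y = prod_dist d y x.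
Proof.
rewrite /prod_dist; congr (limn (series _)); apply/funext => n.
by rewrite bdist_sym.
Qed.

Lemma prod_dist_triangle y x z :
  prod_dist d x z <= prod_dist d x y + prod_dist d y z.
Proof.
have cxy := @is_cvg_prod_dist x y; have cyz := @is_cvg_prod_dist y z.
rewrite -limD//; apply: ler_lim; first exact: is_cvg_prod_dist.
  exact: is_cvgD.
near=> n; rewrite [leRHS]/GRing.add/= /series/= -big_split/=; apply: ler_sum => i _.
by rewrite -mulrDr ler_wpM2l// bdist_triangle.
Unshelve. all: by end_near. Qed.

Lemma prod_dist_nbhs x (A : set (prodSU R)) : nbhs x A ->
  exists2 e, 0 < e & [set y | prod_dist d x y < e] `<=` A.
Proof.
pose B (e : R) := [set y | prod_dist d x y < e].
pose F := filter_from [set e : R | 0 < e] B.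
have FF : Filter F.
  apply: filter_from_filter; first by exists 1 => /=.
  move=> e1 e2 /= e10 e20; exists (Num.min e1 e2).
    by rewrite /= lt_min e10.
  by move=> y; rewrite /B/= lt_min => /andP[].
suff: F --> x by move=> h /h [e e0 eA]; exists e.
apply/cvg_sup => n V [W [[U oU <-] Uxn UV]].
have /(bdist_nbhs (d n)) [e e0 eU] : nbhs (x n) U by exact: open_nbhs_nbhs.
exists (2 ^- n.+1 * e) => /=; first by rewrite mulr_gt0// invr_gt0 exprn_gt0.
move=> y /= xy; apply/UV/eU => /=.
have := le_lt_trans (prod_dist_ge x y n) xy.
by rewrite ltr_pM2l// invr_gt0 exprn_gt0.
Qed.

Lemma SU_hausdorff n (r : biinvariant_metric R n) : hausdorff_space (SU R n).
Proof.
move=> p q pq; apply: (bdist_positivity (b := r)); apply/eqP.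
rewrite eq_le bdist_ge0 andbT; apply/ler_addgt0Pl => e e0; rewrite addr0.
have e2 : 0 < e / 2 by rewrite divr_gt0.
have nb s : nbhs s [set y | r s y < e / 2].
  by apply/(bdist_nbhs r); exists (e / 2).
have [z [/= pz qz]] := pq _ _ (nb p) (nb q).
rewrite (le_trans (bdist_triangle r z _ _))// (bdist_sym r z).
by rewrite [leRHS]splitr lerD// ltW.
Qed.

Lemma prodSU_hausdorff : hausdorff_space (prodSU R).
Proof. by apply: hausdorff_product => n; exact: SU_hausdorff (d n). Qed.

End prod_dist_theory.

Section hausdorff_metric.
Variables (R : realType) (d : forall n, biinvariant_metric R n.+1).
Implicit Types G H K : subgroup_space d.

Definition subgroup_dist G H : R := hausdorff_dist (prod_dist d) G H.

Lemma csg_nonempty (G : compact_subgroup R) : (G : set (prodSU R)) !=set0.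
Proof. by exists 1%g; apply: set_mem; exact: (csg_group G).1. Qed.

Let hdistxx G : subgroup_dist G G = 0.
Proof.
apply: hausdorff_distxx; [exact: prod_dist_ge0|exact: prod_dist_le1|
  exact: prod_distxx|exact: csg_nonempty].
Qed.

Let hdist_sym G H : subgroup_dist G H = subgroup_dist H G.
Proof. exact: maxC. Qed.

Let hdist_triangle H G K :
  subgroup_dist G K <= subgroup_dist G H + subgroup_dist H K.
Proof.
apply: hausdorff_dist_triangle; try exact: csg_nonempty.
- exact: prod_dist_ge0.
- exact: prod_dist_le1.
- exact: prod_dist_triangle.
Qed.

Let hdist_sub G H : subgroup_dist G H = 0 -> csg_set G `<=` csg_set H.
Proof.
move=> GH x Gx.
have : closed (csg_set H).
  by apply: compact_closed; [exact: prodSU_hausdorff d|exact: csg_compact].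
apply => A /(@prod_dist_nbhs _ d) [e e0 eA].
have [|||b Hb xb] := @excess0 _ _ (prod_dist d) _ _ G H x e (csg_nonempty H) _ Gx e0.
- exact: prod_dist_ge0.
- exact: prod_dist_le1.
- by rewrite -GH /subgroup_dist le_max lexx.
- by exists b; split => //; exact: eA.
Qed.

Let hdist_positivity G H : subgroup_dist G H = 0 -> G = H.
Proof.
move=> GH; have : csg_set G = csg_set H.
  by apply/seteqP; split; apply: hdist_sub; rewrite // hdist_sym.
case: G H {GH} => [A cA gA] [B cB gB] /= AB; subst B.
by congr CompactSubgroup; exact: Prop_irrelevance.
Qed.

HB.instance Definition _ := isMetric.Build R (subgroup_space d)
  hdistxx hdist_positivity hdist_sym hdist_triangle.

End hausdorff_metric.

Definition comeager (T : topologicalType) (A : set T) :=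
  exists2 D, Gdelta_dense D & D `<=` A.

Definition finite_order (G : groupType) (g : G) :=
  exists2 n : nat, (0 < n)%N & (g ^+ n = 1)%g.

(* Main.v *)
(* For an open dense set of [G], the projection of [G] to [SU(n)] is onto for
   some [n >= 2], and every such [G] has the required elements.

   Density: replacing [G] by [pi_N(G) x prod_(i > N) SU(i)] moves it by at most
   [2^-N].  Openness: a closed subgroup [Q] of [SU(m)] that is [r]-dense for a
   small [r] is [r/2]-dense, hence everything.  Indeed, modulo [Q] it suffices
   to treat elements at distance [O(r)] from 1; such an element is, up to
   [O(r^(3/2))], a product of commutators of elements at distance [O(r^(1/2))]
   from 1, and the factors can be replaced by elements of [Q] at a cost of
   [O(r^(3/2))].

   If [phi : G -> SU(n)] is onto, [G] contains lifts of elements of infinite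
   order.  For torsion, embed the projection of [G] to finitely many
   coordinates in some [U(m)] by [rho], and let [N] be the kernel of [phi].  For
   [g] near 1 in [SU(n)], let [x] maximize [Re tr rho] on the fibre of [phi] over
   [g].  Such a maximizer near 1 is unique: otherwise pairs [x_k], [x_k z_k] of
   maximizers with [z_k -> 1] yield a tangent direction [Y] of [N], a limit of
   the normalized [rho z_k - 1], with [Re tr (rho x_k Y) = 0] and
   [Re tr (rho (x_k z_k) Y) = 0], so that [Re tr (Y Y) = 0] although [Y] is
   skew-Hermitian and nonzero.  Since [N] acts on the maximizers by conjugation,
   [x] commutes with [N].  Hence the centralizer of [N] maps onto a
   neighbourhood of 1, and contains lifts [a], [b] of the quaternions [i], [j];
   their commutator has order dividing 4 and is not in [N].  A compactness
   argument handles all coordinates simultaneously. *)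
From HB Require Import structures.
Require Import Defs.
From mathcomp Require Import all_boot all_order all_algebra.
From mathcomp Require Import perm complex ring lra zify.
From mathcomp Require Import all_classical all_reals all_analysis.

Set Implicit Arguments.
Unset Strict Implicit.
Unset Printing Implicit Defensive.

Import Order.TTheory GRing.Theory Num.Theory.
Import numFieldNormedType.Exports.

Local Open Scope ring_scope.
Local Open Scope sesquilinear_scope.

(** * The entrywise norm and the real trace *)

Section entrywise_norm.
Variable R : realType.
Local Notation C := R[i].

Definition cabs (z : C) : R := complex.Re `|z|.

Lemma cabsE z : (cabs z)%:C%C = `|z|.
Proof. by rewrite /cabs RRe_real// normr_real. Qed.

Lemma cabs_ge0 z : 0 <= cabs z.
Proof. by rewrite -ler0c cabsE. Qed.

Lemma cabsM z t : cabs (z * t) = cabs z * cabs t.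
Proof. by apply: complexI; rewrite rmorphM /= !cabsE normrM. Qed.

Lemma cabsD z t : cabs (z + t) <= cabs z + cabs t.
Proof. by rewrite -lecR rmorphD /= !cabsE ler_normD. Qed.

Lemma cabsN z : cabs (- z) = cabs z.
Proof. by apply: complexI; rewrite !cabsE normrN. Qed.

Lemma cabs0 : cabs 0 = 0.
Proof. by apply: complexI; rewrite cabsE normr0. Qed.

Lemma cabs0_eq z : cabs z = 0 -> z = 0.
Proof. by move=> z0; apply/eqP; rewrite -normr_eq0 -cabsE z0. Qed.

Lemma cabs1 : cabs 1 = 1.
Proof. by apply: complexI; rewrite cabsE normr1. Qed.

Lemma cabs_conj z : cabs z^* = cabs z.
Proof. by apply: complexI; rewrite !cabsE norm_conjC. Qed.

Lemma cabs_real (r : R) : cabs r%:C%C = `|r|.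
Proof. by apply: complexI; rewrite cabsE normc_def /= expr0n addr0 sqrtr_sqr. Qed.

Lemma cabs_sqr z : cabs z ^+ 2 = complex.Re z ^+ 2 + complex.Im z ^+ 2.
Proof. by apply: complexI; rewrite rmorphXn /= cabsE -add_Re2_Im2. Qed.

Lemma Re_le_cabs z : `|complex.Re z| <= cabs z.
Proof. by rewrite -lecR cabsE normc_ge_Re. Qed.

Lemma Im_le_cabs z : `|complex.Im z| <= cabs z.
Proof.
rewrite -ler_sqr ?nnegrE ?cabs_ge0// cabs_sqr real_normK ?num_real//.
by rewrite lerDr sqr_ge0.
Qed.

Lemma cabs_le_ReIm z : cabs z <= `|complex.Re z| + `|complex.Im z|.
Proof.
rewrite -ler_sqr ?nnegrE ?cabs_ge0 ?addr_ge0// cabs_sqr sqrrD.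
rewrite !real_normK ?num_real// lerD2r lerDl.
by rewrite mulrn_wge0// mulr_ge0.
Qed.

Lemma ReD (z t : C) : complex.Re (z + t) = complex.Re z + complex.Re t.
Proof. by case: z t => ? ? []. Qed.

Lemma ImD (z t : C) : complex.Im (z + t) = complex.Im z + complex.Im t.
Proof. by case: z t => ? ? []. Qed.

Lemma ReN (z : C) : complex.Re (- z) = - complex.Re z.
Proof. by case: z. Qed.

Lemma ImN (z : C) : complex.Im (- z) = - complex.Im z.
Proof. by case: z. Qed.

Lemma Re_sum (I : Type) (s : seq I) (P : pred I) (F : I -> C) :
  complex.Re (\sum_(i <- s | P i) F i) = \sum_(i <- s | P i) complex.Re (F i).
Proof. by apply: (big_morph (@complex.Re R) ReD). Qed.

Lemma Re_mul_real (r : R) (z : C) : complex.Re (r%:C%C * z) = r * complex.Re z.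
Proof. by case: z => a b /=; rewrite mul0r subr0. Qed.

Definition l1 m n (A : 'M[C]_(m, n)) : R := \sum_i \sum_j cabs (A i j).

Section dims.
Variables m n : nat.
Implicit Types A B : 'M[C]_(m, n).

Lemma l1_ge0 A : 0 <= l1 A.
Proof. by apply: sumr_ge0 => i _; apply: sumr_ge0 => j _; exact: cabs_ge0. Qed.

Lemma l1D A B : l1 (A + B) <= l1 A + l1 B.
Proof.
rewrite /l1 -big_split; apply: ler_sum => i _.
rewrite -big_split; apply: ler_sum => j _.
by rewrite mxE cabsD.
Qed.

Lemma l1N A : l1 (- A) = l1 A.
Proof.
by apply: eq_bigr => i _; apply: eq_bigr => j _; rewrite mxE cabsN.
Qed.

Lemma l1B A B : l1 (A - B) <= l1 A + l1 B.
Proof. by rewrite -[l1 B]l1N l1D. Qed.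

Lemma l1BC A B : l1 (A - B) = l1 (B - A).
Proof. by rewrite -l1N opprB. Qed.

Lemma l1_triangle B A D : l1 (A - D) <= l1 (A - B) + l1 (B - D).
Proof. by rewrite -[A - D](subrKA B) l1D. Qed.

Lemma l1_0 : l1 (0 : 'M[C]_(m, n)) = 0.
Proof.
by rewrite /l1 big1// => i _; rewrite big1// => j _; rewrite mxE cabs0.
Qed.

Lemma entry_le_l1 A i j : cabs (A i j) <= l1 A.
Proof.
have row_ge0 k : 0 <= \sum_j cabs (A k j).
  by apply: sumr_ge0 => ? _; exact: cabs_ge0.
rewrite /l1 (bigD1 i)//= (bigD1 j)//= -addrA lerDl addr_ge0//.
  by apply: sumr_ge0 => ? _; exact: cabs_ge0.
by apply: sumr_ge0 => ? _; exact: row_ge0.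
Qed.

Lemma l1_0_eq A : l1 A = 0 -> A = 0.
Proof.
move=> A0; apply/matrixP => i j; rewrite mxE; apply: cabs0_eq.
by apply/eqP; rewrite eq_le cabs_ge0 andbT -A0 entry_le_l1.
Qed.

Lemma l1_le_entry A e : (forall i j, cabs (A i j) <= e) ->
  l1 A <= (m * n)%:R * e.
Proof.
move=> Ae; have -> : (m * n)%:R * e = \sum_(i < m) \sum_(j < n) e.
  by rewrite !sumr_const !card_ord -!mulrnA mulr_natl mulnC.
by apply: ler_sum => i _; apply: ler_sum => j _.
Qed.

Lemma l1Z (r : C) A : l1 (r *: A) = cabs r * l1 A.
Proof.
rewrite /l1 mulr_sumr; apply: eq_bigr => i _.
by rewrite mulr_sumr; apply: eq_bigr => j _; rewrite mxE cabsM.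
Qed.

End dims.

Lemma trCD m n (A B : 'M[C]_(m, n)) : (A + B) ^t* = A ^t* + B ^t*.
Proof. by rewrite raddfD /= map_mxD. Qed.

Lemma trCN m n (A : 'M[C]_(m, n)) : (- A) ^t* = - A ^t*.
Proof. by rewrite raddfN /= map_mxN. Qed.

Lemma trC1 n : (1%:M : 'M[C]_n) ^t* = 1%:M.
Proof. by rewrite trmx1 map_mx1. Qed.

Lemma trCM m n p (A : 'M[C]_(m, n)) (B : 'M[C]_(n, p)) :
  (A *m B) ^t* = B ^t* *m A ^t*.
Proof. by rewrite trmx_mul map_mxM. Qed.

Lemma conjC_real (r : R) : (r%:C%C)^* = r%:C%C.
Proof. by apply: conj_Creal; rewrite complex_real. Qed.

Lemma trCZ m n (r : R) (A : 'M[C]_(m, n)) :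
  (r%:C%C *: A) ^t* = r%:C%C *: A ^t*.
Proof. by apply/matrixP => i j; rewrite !mxE rmorphM /= conjC_real. Qed.

Lemma l1_trC m n (A : 'M[C]_(m, n)) : l1 (A ^t*) = l1 A.
Proof.
rewrite /l1 exchange_big; apply: eq_bigr => i _; apply: eq_bigr => j _.
by rewrite !mxE cabs_conj.
Qed.

Lemma cabs_sum (I : Type) (s : seq I) (P : pred I) (F : I -> C) :
  cabs (\sum_(i <- s | P i) F i) <= \sum_(i <- s | P i) cabs (F i).
Proof.
elim/big_ind2: _ => [|x a y b xa yb|//]; first by rewrite cabs0.
by rewrite (le_trans (cabsD _ _))// lerD.
Qed.

Lemma l1M m n p (A : 'M[C]_(m, n)) (B : 'M[C]_(n, p)) :
  l1 (A *m B) <= l1 A * l1 B.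
Proof.
rewrite /l1 mulr_suml; apply: ler_sum => i _.
apply: (@le_trans _ _ (\sum_j \sum_k cabs (A i k) * cabs (B k j))).
  apply: ler_sum => j _; rewrite mxE (le_trans (cabs_sum _ _ _))//.
  by apply: ler_sum => k _; rewrite cabsM.
rewrite exchange_big/= mulr_suml; apply: ler_sum => k _.
rewrite -mulr_sumr; apply: ler_wpM2l; first exact: cabs_ge0.
rewrite [leRHS](bigD1 k)//= lerDl; apply: sumr_ge0 => ? _.
by apply: sumr_ge0 => ? _; exact: cabs_ge0.
Qed.

Lemma l1_mulB p (a b a' b' : 'M[C]_p) :
  l1 (a *m b - a' *m b') <= l1 (a - a') * l1 b + l1 a' * l1 (b - b').
Proof.
have -> : a *m b - a' *m b' = (a - a') *m b + a' *m (b - b').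
  by rewrite mulmxBl mulmxBr addrA subrK.
by rewrite (le_trans (l1D _ _))// lerD ?l1M.
Qed.

Section square.
Variable n : nat.
Implicit Types (A B U : 'M[C]_n).

Definition Retr A : R := complex.Re (\tr A).

Lemma RetrD A B : Retr (A + B) = Retr A + Retr B.
Proof. by rewrite /Retr mxtraceD ReD. Qed.

Lemma RetrN A : Retr (- A) = - Retr A.
Proof. by rewrite /Retr raddfN ReN. Qed.

Lemma RetrB A B : Retr (A - B) = Retr A - Retr B.
Proof. by rewrite RetrD RetrN. Qed.

Lemma Retr_mulC A B : Retr (A *m B) = Retr (B *m A).
Proof. by rewrite /Retr mxtrace_mulC. Qed.

Lemma RetrZ (r : R) A : Retr (r%:C%C *: A) = r * Retr A.
Proof. by rewrite /Retr mxtraceZ Re_mul_real. Qed.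

Lemma Retr1 : Retr 1%:M = n%:R.
Proof. by rewrite /Retr mxtrace1 -(rmorph_nat (real_complex R)). Qed.

Lemma Re_conj (z : C) : complex.Re z^* = complex.Re z.
Proof. by case: z. Qed.

Lemma Retr_trC A : Retr (A ^t*) = Retr A.
Proof.
rewrite /Retr /mxtrace !Re_sum; apply: eq_bigr => i _.
by rewrite !mxE Re_conj.
Qed.

Lemma Retr_le_l1 A : `|Retr A| <= l1 A.
Proof.
rewrite /Retr (le_trans (Re_le_cabs _))// (le_trans (cabs_sum _ _ _))//.
apply: ler_sum => i _; rewrite (bigD1 i)//= lerDl.
by apply: sumr_ge0 => ? _; exact: cabs_ge0.
Qed.

Lemma Retr_mul_trC A : Retr (A *m A ^t*) = \sum_i \sum_j cabs (A i j) ^+ 2.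
Proof.
rewrite /Retr /mxtrace Re_sum; apply: eq_bigr => i _.
rewrite mxE Re_sum; apply: eq_bigr => j _; rewrite !mxE -normCK -cabsE.
by rewrite -rmorphXn.
Qed.

Lemma unitary_mulmxV U : U \is unitarymx -> U *m U ^t* = 1%:M.
Proof. by move/unitarymxP. Qed.

Lemma unitary_mulVmx U : U \is unitarymx -> U ^t* *m U = 1%:M.
Proof. by move=> uU; apply: mulmx1C; exact: unitary_mulmxV. Qed.

Lemma unitaryM A B : A \is unitarymx -> B \is unitarymx ->
  A *m B \is unitarymx.
Proof. by move=> uA uB; apply: (mul_unitarymx uA uB). Qed.

Lemma unitaryV A : A \is unitarymx -> A ^t* \is unitarymx.
Proof. by rewrite trmxC_unitary. Qed.

Lemma cabs_unitary U i j : U \is unitarymx -> cabs (U i j) <= 1.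
Proof.
move=> /unitarymxP /matrixP/(_ i i); rewrite !mxE eqxx.
move=> /(congr1 (@complex.Re R)); rewrite Re_sum /=.
under eq_bigr do rewrite !mxE -normCK -cabsE -rmorphXn /=.
rewrite -ler_sqr ?nnegrE ?cabs_ge0// expr1n => <-.
rewrite [leRHS](bigD1 j)//= lerDl.
by apply: sumr_ge0 => ? _; exact: sqr_ge0.
Qed.

Lemma l1_unitary U : U \is unitarymx -> l1 U <= (n * n)%:R.
Proof.
by move=> uU; rewrite -[leRHS]mulr1 l1_le_entry// => i j; exact: cabs_unitary.
Qed.

Lemma l1_unitaryMl U A : U \is unitarymx -> l1 (U *m A) <= (n * n)%:R * l1 A.
Proof.
move=> uU; rewrite (le_trans (l1M _ _))// ler_wpM2r ?l1_ge0//.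
exact: l1_unitary.
Qed.

Lemma l1_unitaryMr U A : U \is unitarymx -> l1 (A *m U) <= (n * n)%:R * l1 A.
Proof.
move=> uU; rewrite (le_trans (l1M _ _))// mulrC ler_wpM2r ?l1_ge0//.
exact: l1_unitary.
Qed.

Lemma hs_dist_unitary U : U \is unitarymx ->
  \sum_i \sum_j cabs ((U - 1%:M) i j) ^+ 2 = 2 * (n%:R - Retr U).
Proof.
move=> uU; rewrite -Retr_mul_trC trCD trCN trC1.
rewrite mulmxBr mulmx1 mulmxBl mul1mx (unitary_mulmxV uU).
rewrite !RetrB Retr1 Retr_trC; ring.
Qed.

End square.

End entrywise_norm.

(** * Maximizers of the real trace on cosets *)

Section cluster_points.
Variable R : realType.

Lemma bounded_cluster (I : finType) (f : nat -> I -> R) (b : R) :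
  (forall k i, `|f k i| <= b) ->
  exists l : I -> R, forall e K, 0 < e ->
    exists2 k, (K <= k)%N & forall i, `|f k i - l i| < e.
Proof.
move=> fb; pose A (_ : 'I_#|I|) := `[- b, b]%classic : set R.
have cA : compact [set v : 'rV[R]_#|I| | forall i, A i (v ord0 i)].
  by apply: rV_compact => i; exact: segment_compact.
pose u k : 'rV[R]_#|I| := \row_j f k (enum_val j).
have [|l [_ cl]] := cA (u @ \oo)%classic _.
  exists 0%N => // k _ i; rewrite /A /= mxE in_itv /=.
  by rewrite -ler_norml.
exists (fun i => l ord0 (enum_rank i)) => e K e0.
have [||x [[k /= Kk <-]]] := cl [set u k | k in [set k | (K <= k)%N]]%classic
  (ball l e).
- by exists K => // k /= Kk; exists k.
- exact: nbhsx_ballx.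
move=> [_ luk]; exists k => // i; have := luk ord0 (enum_rank i).
by rewrite mxE enum_rankK -ball_normE /= distrC.
Qed.

Lemma bounded_mx_cluster m n (Y : nat -> 'M[R[i]]_(m, n)) (b : R) :
  (forall k, l1 (Y k) <= b) ->
  exists L : 'M[R[i]]_(m, n), forall e K, 0 < e ->
    exists2 k, (K <= k)%N & l1 (Y k - L) < e.
Proof.
move=> Yb; pose f k (ijb : 'I_m * 'I_n * bool) : R :=
  let z := Y k ijb.1.1 ijb.1.2 in
  if ijb.2 then complex.Re z else complex.Im z.
have [|l fl] := @bounded_cluster _ f b.
  move=> k [[i j] []]; rewrite /f /=.
    by rewrite (le_trans (Re_le_cabs _))// (le_trans (entry_le_l1 _ _ _)).
  by rewrite (le_trans (Im_le_cabs _))// (le_trans (entry_le_l1 _ _ _)).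
exists (\matrix_(i, j) (l (i, j, true) +i* l (i, j, false))%C) => e K e0.
pose c : R := 1 + (m * n)%:R * 2.
have c0 : 0 < c by rewrite /c ltr_pwDl// mulr_ge0.
have [|k Kk fk] := fl (e / c) K; first by rewrite divr_gt0.
exists k => //; apply: (@le_lt_trans _ _ ((m * n)%:R * (2 * (e / c)))).
  apply: l1_le_entry => i j; rewrite !mxE (le_trans (cabs_le_ReIm _))//.
  rewrite mulr_natl mulr2n lerD// ltW//.
    by have := fk (i, j, true); rewrite /f /= ReD ReN.
  by have := fk (i, j, false); rewrite /f /= ImD ImN.
rewrite !mulrA ltr_pdivrMr// /c; lra.
Qed.

End cluster_points.

Section centralizing_maximizers.
Variables (R : realType) (m : nat) (T : groupType) (rho : T -> 'M[R[i]]_m).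
Hypothesis rhoM : forall x y, rho (x * y)%g = rho x *m rho y.
Hypothesis rho_unitary : forall x, rho x \is unitarymx.
Variable N : set T.
Hypothesis N1 : N 1%g.
Hypothesis NM : forall x y, N x -> N y -> N (x * y)%g.
Hypothesis NV : forall x, N x -> N (x^-1)%g.

Let k : R := (m * m)%:R.
Let k_ge0 : 0 <= k. Proof. by rewrite ler0n. Qed.

Let rho1 : rho 1%g = 1%:M.
Proof.
have := rhoM 1%g 1%g; rewrite mulg1 => /(congr1 (mulmx (rho 1%g ^t*))).
by rewrite mulmxA unitary_mulVmx// mul1mx => <-.
Qed.

Let rhoV x : rho (x^-1)%g = rho x ^t*.
Proof.
have : rho x ^t* *m (rho x *m rho (x^-1)%g) = rho x ^t*.
  by rewrite -rhoM mulgV rho1 mulmx1.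
by rewrite mulmxA unitary_mulVmx// mul1mx.
Qed.

Lemma l1_rho_powB x j :
  l1 (rho (x ^+ j)%g - 1%:M) <= k * (j%:R * l1 (rho x - 1%:M)).
Proof.
set delta := l1 (rho x - 1%:M).
elim: j => [|j IHj]; first by rewrite expg0 rho1 subrr l1_0 mul0r mulr0.
have -> : rho (x ^+ j.+1)%g - 1%:M
    = rho (x ^+ j)%g *m (rho x - 1%:M) + (rho (x ^+ j)%g - 1%:M).
  by rewrite mulmxBr mulmx1 subrKA -rhoM -expgSr.
rewrite (le_trans (l1D _ _))//.
have := l1_unitaryMl (rho x - 1%:M) (rho_unitary (x ^+ j)%g).
rewrite -/delta -/k -addn1 natrD => h; lra.
Qed.

Lemma l1_rho_pow2 x j :
  l1 (rho (x ^+ j)%g - 1%:M - j%:R%:C%C *: (rho x - 1%:M))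
    <= k * (j%:R * l1 (rho x - 1%:M)) ^+ 2.
Proof.
set delta := l1 (rho x - 1%:M).
have d0 : 0 <= delta by exact: l1_ge0.
elim: j => [|j IHj].
  by rewrite expg0 rho1 subrr scale0r subrr l1_0 mul0r expr0n mulr0.
have -> : rho (x ^+ j.+1)%g - 1%:M - j.+1%:R%:C%C *: (rho x - 1%:M)
  = (rho (x ^+ j)%g - 1%:M) *m (rho x - 1%:M)
    + (rho (x ^+ j)%g - 1%:M - j%:R%:C%C *: (rho x - 1%:M)).
  rewrite mulmxBl mulmxBr mulmx1 mul1mx -rhoM -expgSr mulrSr rmorphD /= scalerDl scale1r.
  set a := rho (x ^+ j.+1)%g; set b := rho (x ^+ j)%g; set c := _ *: _.
  by apply/matrixP => i i'; rewrite !mxE; ring.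
rewrite (le_trans (l1D _ _))//.
have h1 := l1M (rho (x ^+ j)%g - 1%:M) (rho x - 1%:M).
have h2 : l1 (rho (x ^+ j)%g - 1%:M) * l1 (rho x - 1%:M) <= k * (j%:R * delta) * delta.
  by rewrite ler_wpM2r// l1_rho_powB.
have h3 : 0 <= k * (j%:R * delta * delta) by rewrite !mulr_ge0.
have h4 : 0 <= k * delta ^+ 2 by rewrite mulr_ge0// sqr_ge0.
rewrite -addn1 natrD; nra.
Qed.

(* [Y] belongs to the Lie algebra of the closure of [rho @` N]. *)
Definition tangent (Y : 'M[R[i]]_m) := exists2 c : R, 0 <= c &
  forall s : R, 0 < s -> s <= 1 ->
    exists2 u, N u & l1 (rho u - 1%:M - s%:C%C *: Y) <= c * s ^+ 2.

Lemma tangent_cluster (n : nat -> T) (Y : 'M[R[i]]_m) :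
  (forall j, N (n j)) -> (forall j, rho (n j) <> 1%:M) ->
  (forall e s : R, 0 < e -> 0 < s -> exists j,
    l1 (rho (n j) - 1%:M) < e /\
    l1 ((l1 (rho (n j) - 1%:M))^-1%:C%C *: (rho (n j) - 1%:M) - Y) < s) ->
  tangent Y.
Proof.
move=> Nn n1 cl; exists (k + 2); first by rewrite addr_ge0.
move=> s s0 s1.
have [|j []] := cl (s ^+ 2) s _ s0; first by rewrite exprn_gt0.
set z := rho (n j) - 1%:M; set delta := l1 z => ds ys.
have d0 : 0 < delta.
  rewrite lt_def l1_ge0 andbT; apply/eqP => /l1_0_eq /eqP.
  by rewrite subr_eq0 => /eqP; exact: n1.
pose q := Num.truncn (s / delta).
have /andP[q1 q2] : q%:R <= s / delta < q.+1%:R.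
  by apply: truncn_itv; rewrite divr_ge0// ltW.
rewrite ler_pdivlMr// in q1; rewrite ltr_pdivrMr// in q2.
exists (n j ^+ q)%g.
  by elim: q {q1 q2} => [//|q IHq]; rewrite expgS; exact: NM.
have h := l1_rho_pow2 (n j) q; rewrite -/z -/delta in h.
set Yj := _ *: z in ys.
have zE : z = delta%:C%C *: Yj.
  by rewrite /Yj scalerA -rmorphM /= divff ?gt_eqF// scale1r.
have Yj1 : l1 Yj = 1.
  by rewrite /Yj l1Z cabs_real gtr0_norm ?invr_gt0// mulVf ?gt_eqF.
clearbody Yj.
have -> : rho (n j ^+ q)%g - 1%:M - s%:C%C *: Y =
    (rho (n j ^+ q)%g - 1%:M - q%:R%:C%C *: z)
    + ((q%:R * delta - s)%:C%C *: Yj + s%:C%C *: (Yj - Y)).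
  rewrite [in RHS]zE scalerA -rmorphM /= rmorphB /= scalerBl scalerBr.
  by rewrite subrKA addrA subrK.
rewrite (le_trans (l1D _ _))//.
have h2 := l1D ((q%:R * delta - s)%:C%C *: Yj) (s%:C%C *: (Yj - Y)).
rewrite !l1Z !cabs_real Yj1 mulr1 (gtr0_norm s0) in h2.
have h3 : `|q%:R * delta - s| <= s ^+ 2.
  apply/ltW/(le_lt_trans _ ds); rewrite distrC ger0_norm ?subr_ge0// lerBlDl.
  by rewrite (le_trans (ltW q2))// -addn1 natrD mulrDl mul1r.
have h4 : s * l1 (Yj - Y) <= s ^+ 2 by rewrite expr2 ler_wpM2l ?ltW.
have h5 : k * (q%:R * delta) ^+ 2 <= k * s ^+ 2.
  by rewrite ler_wpM2l// ler_sqr ?nnegrE ?(ltW s0)// mulr_ge0// ltW.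
rewrite mulrDl; lra.
Qed.

Lemma ler0_of_quadratic (a b : R) : 0 <= b ->
  (forall s, 0 < s -> s <= 1 -> s * a <= b * s ^+ 2) -> a <= 0.
Proof.
move=> b0 h; rewrite leNgt; apply/negP => a0.
pose s := Num.min 1 (a / (2 * (b + 1))).
have b1 : 0 < 2 * (b + 1) by lra.
have s0 : 0 < s by rewrite lt_min ltr01 divr_gt0.
have := h s s0; rewrite ge_min lexx => /(_ isT).
rewrite expr2 mulrCA ler_pM2l//.
have : s <= a / (2 * (b + 1)) by rewrite ge_min lexx orbT.
rewrite ler_pdivlMr// => *; nra.
Qed.

Lemma tangent_skew Y : tangent Y -> Y ^t* = - Y.
Proof.
move=> [c c0 tY]; apply/eqP; rewrite -addr_eq0 addrC; apply/eqP/l1_0_eq.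
apply/eqP; rewrite eq_le l1_ge0 andbT.
apply: (@ler0_of_quadratic _ (2 * c + (l1 Y + c) ^+ 2)).
  by apply: addr_ge0; [exact: mulr_ge0|exact: sqr_ge0].
move=> s s0 s1; have [u Nu] := tY s s0 s1.
set E := _ - _ => hE.
have zE : rho u - 1%:M = s%:C%C *: Y + E by rewrite /E [RHS]addrC subrK.
have lz : l1 (rho u - 1%:M) <= (l1 Y + c) * s.
  rewrite zE (le_trans (l1D _ _))// l1Z cabs_real gtr0_norm//.
  have : c * s ^+ 2 <= c * s by rewrite ler_wpM2l// expr2 ler_piMr// ltW.
  lra.
have sY : s%:C%C *: (Y + Y ^t*) =
    - (E + E ^t*) - (rho u - 1%:M) *m (rho u - 1%:M) ^t*.
  have E2 : (rho u - 1%:M) + (rho u - 1%:M) ^t* = s%:C%C *: (Y + Y^t*) + (E + E^t*).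
    by rewrite zE trCD trCZ scalerDr addrACA.
  apply: (addIr (E + E ^t*)); rewrite -E2 [RHS]addrAC addNr add0r.
  rewrite trCD trCN trC1 mulmxBr mulmx1 mulmxBl mul1mx.
  rewrite unitary_mulmxV//.
  by move: (rho u) (rho u ^t*) => a b; apply/matrixP => i j; rewrite !mxE; ring.
have : l1 (s%:C%C *: (Y + Y ^t*)) <= 2 * (c * s ^+ 2) + ((l1 Y + c) * s) ^+ 2.
  rewrite sY (le_trans (l1B _ _))// lerD//.
    by rewrite l1N (le_trans (l1D _ _))// l1_trC; lra.
  rewrite (le_trans (l1M _ _))// l1_trC expr2 ler_pM ?l1_ge0//.
rewrite l1Z cabs_real gtr0_norm//; nra.
Qed.

Lemma tangentN Y : tangent Y -> tangent (- Y).
Proof.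
move=> tY; have skY := tangent_skew tY; case: tY => c c0 tY.
exists c => // s s0 s1; have [u Nu hu] := tY s s0 s1.
exists (u^-1)%g; first exact: NV.
apply: le_trans hu; rewrite rhoV -skY -[leRHS]l1_trC.
by rewrite !(trCD, trCN) trC1 trCZ.
Qed.

Definition maximal_on_coset (x : T) :=
  forall u, N u -> Retr (rho (x * u)%g) <= Retr (rho x).

Lemma maximal_on_cosetM x n :
  maximal_on_coset x -> N n -> Retr (rho (x * n)%g) = Retr (rho x) ->
  maximal_on_coset (x * n)%g.
Proof. by move=> mx Nn xn u Nu; rewrite -mulgA xn; apply/mx/NM. Qed.

Lemma maximal_tangent_le0 x Y :
  maximal_on_coset x -> tangent Y -> Retr (rho x *m Y) <= 0.
Proof.
move=> mx [c c0 tY].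
apply: (@ler0_of_quadratic _ (k * c)); first exact: mulr_ge0.
move=> s s0 s1; have [u Nu hu] := tY s s0 s1.
set E := _ - _ in hu.
have uE : rho u = E + s%:C%C *: Y + 1%:M by rewrite /E !subrK.
clearbody E; have := mx _ Nu; rewrite rhoM uE !mulmxDr mulmx1 !RetrD -scalemxAr RetrZ => h.
have := Retr_le_l1 (rho x *m E); rewrite ler_norml => /andP[h1 _].
have h2 := l1_unitaryMl E (rho_unitary x).
have : k * l1 E <= k * (c * s ^+ 2) by rewrite ler_wpM2l.
by rewrite -/k in h2; move=> ?; lra.
Qed.

Lemma maximal_tangent0 x Y :
  maximal_on_coset x -> tangent Y -> Retr (rho x *m Y) = 0.
Proof.
move=> mx tY; apply/eqP; rewrite eq_le maximal_tangent_le0//=.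
by rewrite -oppr_le0 -RetrN -mulmxN maximal_tangent_le0//; exact: tangentN.
Qed.

Lemma maximal_unique : exists2 e : R, 0 < e & forall x n,
  maximal_on_coset x -> N n -> maximal_on_coset (x * n)%g ->
  l1 (rho x - 1%:M) < e -> l1 (rho n - 1%:M) < e -> rho n = 1%:M.
Proof.
apply: contrapT => nex.
have seq_ex (j : nat) : exists xn : T * T,
    [/\ maximal_on_coset xn.1, N xn.2, maximal_on_coset (xn.1 * xn.2)%g,
      l1 (rho xn.1 - 1%:M) < j.+1%:R^-1 /\ l1 (rho xn.2 - 1%:M) < j.+1%:R^-1 &
      rho xn.2 <> 1%:M].
  apply: contrapT => nxn; apply: nex; exists j.+1%:R^-1; first by rewrite invr_gt0.
  move=> x n mx Nn mxn hx hn; apply: contrapT => n1.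
  by apply: nxn; exists (x, n).
have [xn xnP] := choice seq_ex.
pose x j := (xn j).1; pose n j := (xn j).2.
pose delta j := l1 (rho (n j) - 1%:M).
pose Y j : 'M[R[i]]_m := (delta j)^-1%:C%C *: (rho (n j) - 1%:M).
have d0 j : 0 < delta j.
  rewrite lt_def l1_ge0 andbT; apply/eqP => /l1_0_eq /eqP.
  by rewrite subr_eq0 => /eqP; have [] := xnP j.
have lY j : l1 (Y j) = 1.
  by rewrite l1Z cabs_real gtr0_norm ?invr_gt0// mulVf ?gt_eqF.
have [|L hL] := @bounded_mx_cluster _ _ _ Y 1; first by move=> j; rewrite lY.
have small (e : R) : 0 < e -> exists K, forall j, (K <= j)%N -> j.+1%:R^-1 < e.
  move=> e0; exists (Num.truncn e^-1) => j Kj.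
  rewrite invf_plt ?posrE//.
  have /andP[_ h] : (Num.truncn e^-1)%:R <= e^-1 < (Num.truncn e^-1).+1%:R.
    by apply: truncn_itv; rewrite invr_ge0 ltW.
  by apply: lt_le_trans h _; rewrite ler_nat ltnS.
have tL : tangent L.
  apply: (@tangent_cluster n) => [j|j|e s e0 s0].
  - by have [] := xnP j.
  - by have [] := xnP j.
  have [K hK] := small e e0; have [j Kj hj] := hL s K s0.
  exists j; split; last exact: hj.
  by have [_ _ _ [_ h] _] := xnP j; rewrite (lt_trans h)// hK.
pose q := \sum_i \sum_j cabs (L i j) ^+ 2.
have q0 : 0 < q.
  have qi0 i : 0 <= \sum_j cabs (L i j) ^+ 2.
    by apply: sumr_ge0 => j _; exact: sqr_ge0.
  rewrite lt_def; apply/andP; split; last by apply: sumr_ge0 => i _.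
  apply/eqP => /psumr_eq0P => q_eq0; have L0 : L = 0.
    apply/matrixP => i j; rewrite mxE; apply: cabs0_eq; apply/eqP.
    have /psumr_eq0P/(_ j isT)/eqP := q_eq0 (fun i _ => qi0 i) i isT.
    by rewrite sqrf_eq0; apply => l _; exact: sqr_ge0.
  have [j _] := hL 2^-1 0%N ltac:(by rewrite invr_gt0).
  by rewrite L0 subr0 lY; lra.
have qE : Retr (L *m L) = - q.
  rewrite -[X in _ *m X]opprK -(tangent_skew tL) mulmxN RetrN Retr_mul_trC.
  by [].
have lL0 : 0 <= l1 L by exact: l1_ge0.
pose e := q / (4 * (1 + l1 L)).
have e0 : 0 < e by rewrite divr_gt0//; lra.
have eL : e * l1 L <= q / 4.
  have : e * (4 * (1 + l1 L)) = q by rewrite divfK// gt_eqF//; lra.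
  move=> *; nra.
have [K hK] := small e e0; have [j Kj hj] := hL e K e0.
have [mx Nn mxn [hx _] _] := xnP j; rewrite -/(x j) -/(n j) in mx mxn Nn hx.
have h1 := maximal_tangent0 mx tL; have h2 := maximal_tangent0 mxn tL.
have h3 : Retr (rho (x j) *m Y j *m L) = 0.
  rewrite /Y -scalemxAr -scalemxAl RetrZ mulmxBr mulmx1 mulmxBl -rhoM RetrB.
  by rewrite h1 h2 subrr mulr0.
have : Retr (rho (x j) *m Y j *m L) - Retr (L *m L) =
    Retr ((rho (x j) - 1%:M) *m Y j *m L) + Retr ((Y j - L) *m L).
  by rewrite -RetrB -RetrD !mulmxBl mul1mx subrKA.
rewrite h3 qE sub0r opprK.
have := Retr_le_l1 ((rho (x j) - 1%:M) *m Y j *m L).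
have := Retr_le_l1 ((Y j - L) *m L).
rewrite !ler_norml => /andP[_ b1] /andP[_ b2].
have b3 : l1 ((Y j - L) *m L) <= e * l1 L.
  by rewrite (le_trans (l1M _ _))// ler_wpM2r// ltW.
have b4 : l1 ((rho (x j) - 1%:M) *m Y j *m L) <= e * l1 L.
  rewrite (le_trans (l1M _ _))// ler_wpM2r// (le_trans (l1M _ _))// lY mulr1.
  by rewrite ltW// (lt_trans hx)// hK.
move=> *; lra.
Qed.

Lemma maximal_centralizes : exists2 e : R, 0 < e & forall x,
  maximal_on_coset x -> (forall n, N n -> N (x^-1 * n * x)%g) ->
  l1 (rho x - 1%:M) < e -> forall n, N n -> rho x *m rho n = rho n *m rho x.
Proof.
have [e e0 uniq_max] := maximal_unique.
exists (Num.min e (e / (k * (k * k + 1) + 1))).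
  rewrite lt_min e0 divr_gt0// ltr_pwDr//.
  by rewrite !(mulr_ge0, addr_ge0).
move=> x mx xN; rewrite lt_min => /andP[xe]; rewrite ltr_pdivlMr; last first.
  by rewrite ltr_pwDr// !(mulr_ge0, addr_ge0).
move=> xe' n Nn.
pose z := (x^-1 * n * x * n^-1)%g.
have xz : (x * z = n * x * n^-1)%g by rewrite /z !mulgA mulgV mul1g.
have Nz : N z by apply: NM; [exact: xN|exact: NV].
have conjE y : Retr (rho (n * y * n^-1)%g) = Retr (rho y).
  rewrite !rhoM Retr_mulC mulmxA -rhoM mulVg rho1 mul1mx //.
have mxz : maximal_on_coset (x * z)%g.
  by apply: maximal_on_cosetM => //; rewrite xz conjE.
suff : rho z = 1%:M.
  have : (x * n * (n^-1 * z * n) = n * x)%g.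
    by rewrite /z !mulgA mulgK mulgV mul1g mulgVK.
  move=> /(congr1 rho); rewrite !rhoM => <- ->.
  by rewrite mulmx1 -(rhoM (n^-1)%g) mulVg rho1 mulmx1.
apply: uniq_max Nz mxz xe _ => //.
have -> : rho z - 1%:M = rho (x^-1)%g *m
    (rho n *m ((rho x - 1%:M) *m rho (n^-1)%g) - (rho x - 1%:M)).
  rewrite mulmxBl mul1mx !mulmxBr -!rhoM mulmx1 !mulgA mulgK mulVg rho1.
  rewrite -/z; move: (rho z) (rho _) => a b.
  by apply/matrixP => i j; rewrite !mxE; ring.
have h1 := l1_unitaryMl (rho n *m ((rho x - 1%:M) *m rho (n^-1)%g) - (rho x - 1%:M))
  (rho_unitary (x^-1)%g).
have h2 := l1B (rho n *m ((rho x - 1%:M) *m rho (n^-1)%g)) (rho x - 1%:M).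
have h3 := l1_unitaryMl ((rho x - 1%:M) *m rho (n^-1)%g) (rho_unitary n).
have h4 := l1_unitaryMr (rho x - 1%:M) (rho_unitary (n^-1)%g).
have d0 := l1_ge0 (rho x - 1%:M).
rewrite -/k in h1 h3 h4; set d := l1 (rho x - 1%:M) in h2 h4 d0 xe'.
apply: le_lt_trans xe'; apply: le_trans h1 _.
have : k * (k * (k * d) + d) <= d * (k * (k * k + 1) + 1).
  by rewrite -subr_ge0; apply: le_trans d0 _; rewrite le_eqVlt;
    apply/orP; left; apply/eqP; ring.
apply: le_trans; rewrite ler_wpM2l// (le_trans h2)// lerD2r (le_trans h3)//.
by rewrite ler_wpM2l.
Qed.

End centralizing_maximizers.

(** * Embedded quaternions *)

Section special_unitary.
Variable R : realType.
Local Notation C := R[i].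

Definition is_SU m (A : 'M[C]_m) := A \is unitarymx /\ \det A = 1.

Lemma is_SU_trC m (A : 'M[C]_m) : is_SU A -> is_SU (A ^t*).
Proof.
by case=> uA dA; split; rewrite ?trmxC_unitary// det_map_mx det_tr dA rmorph1.
Qed.

Lemma is_SUM m (A B : 'M[C]_m) : is_SU A -> is_SU B -> is_SU (A *m B).
Proof.
move=> [uA dA] [uB dB]; split; first exact: unitaryM uA uB.
by rewrite det_mulmx dA dB mulr1.
Qed.

Lemma is_SU_conj m (V A : 'M[C]_m) : V \is unitarymx -> is_SU A ->
  is_SU (V ^t* *m A *m V).
Proof.
move=> uV [uA dA]; split.
  exact: unitaryM (unitaryM (unitaryV uV) uA) uV.
by rewrite !det_mulmx dA mulr1 -det_mulmx unitary_mulVmx// det1.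
Qed.

Lemma det_1D_mulmxC m p (A : 'M[C]_(m, p)) (B : 'M[C]_(p, m)) :
  \det (1%:M + A *m B) = \det (1%:M + B *m A).
Proof.
have <- : \det (block_mx 1%:M (- A) B 1%:M) = \det (1%:M + A *m B).
  have -> : block_mx 1%:M (- A) B 1%:M =
      block_mx 1%:M (- A) 0 1%:M *m block_mx (1%:M + A *m B) 0 B 1%:M.
    rewrite mulmx_block !mul1mx ?mul0mx ?mulmx0 !mulmx1 mulNmx addrK.
    by rewrite !add0r.
  by rewrite det_mulmx det_ublock det_lblock !det1 !mulr1 mul1r.
have -> : block_mx 1%:M (- A) B 1%:M =
    block_mx 1%:M 0 B 1%:M *m block_mx 1%:M (- A) 0 (1%:M + B *m A).
  rewrite mulmx_block !mul1mx ?mul0mx ?mulmx0 !mulmx1 mulmxN !addr0 addrCA.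
  by rewrite addNr addr0.
by rewrite det_mulmx det_ublock det_lblock !det1 !mul1r.
Qed.

Section embedding.
Variables (m p : nat) (J : 'M[C]_(m, p)).
Hypothesis JJ : J ^t* *m J = 1%:M.
Implicit Types A B : 'M[C]_p.

Definition emb A : 'M[C]_m := 1%:M + J *m (A - 1%:M) *m J ^t*.

Lemma emb1 : emb 1%:M = 1%:M.
Proof. by rewrite /emb subrr mulmx0 mul0mx addr0. Qed.

Lemma embM A B : emb (A *m B) = emb A *m emb B.
Proof.
have -> : A *m B = 1%:M + ((A - 1%:M) *m (B - 1%:M) + (A - 1%:M) + (B - 1%:M)).
  rewrite mulmxBr mulmxBl mulmx1 mul1mx.
  by move: (A *m B) => D; apply/matrixP => i j; rewrite !mxE; ring.
rewrite /emb; move: (A - 1%:M) (B - 1%:M) => X Y.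
rewrite addrAC subrr add0r.
have JXY : (J *m X *m J ^t*) *m (J *m Y *m J ^t*) = J *m (X *m Y) *m J ^t*.
  by rewrite -!mulmxA (mulmxA (J ^t*) J) JJ mul1mx.
rewrite [RHS]mulmxDr mulmx1 mulmxDl mul1mx JXY !mulmxDr !mulmxDl.
move: (J *m X *m _) (J *m Y *m _) (J *m _ *m _) => a b c.
by apply/matrixP => i j; rewrite !mxE; ring.
Qed.

Lemma emb_trC A : (emb A) ^t* = emb (A ^t*).
Proof. by rewrite /emb trCD trC1 !trCM trmxCK trCD trCN trC1 mulmxA. Qed.

Lemma emb_inj : injective emb.
Proof.
move=> A B AB.
have E (X : 'M[C]_p) : J ^t* *m (emb X - 1%:M) *m J = X - 1%:M.
  by rewrite /emb addrC addKr -!mulmxA JJ mulmx1 mulmxA JJ mul1mx.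
by apply: (addIr (- 1%:M)); rewrite -(E A) -(E B) AB.
Qed.

Lemma det_emb A : \det (emb A) = \det A.
Proof.
by rewrite /emb -mulmxA det_1D_mulmxC -mulmxA JJ mulmx1 addrC subrK.
Qed.

Lemma is_SU_emb A : is_SU A -> is_SU (emb A).
Proof.
move=> [/unitarymxP uA dA]; split; last by rewrite det_emb.
by apply/unitarymxP; rewrite emb_trC -embM uA emb1.
Qed.

Lemma l1_embB A B : l1 (emb A - emb B) <= l1 J * l1 J * l1 (A - B).
Proof.
have -> : emb A - emb B = J *m (A - B) *m J ^t*.
  have -> : A - B = (A - 1%:M) - (B - 1%:M) by rewrite opprB addrA subrK.
  rewrite mulmxBr mulmxBl /emb.
  by move: (J *m _ *m _) (J *m _ *m _) => a b; apply/matrixP => i j; rewrite !mxE; ring.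
rewrite (le_trans (l1M _ _))// l1_trC mulrAC ler_wpM2r ?l1_ge0//.
exact: l1M.
Qed.

End embedding.

Definition quat (z w : C) : 'M[C]_2 :=
  \matrix_(i, j) if i == 0 then if j == 0 then z else w
                 else if j == 0 then - w^* else z^*.

Lemma quat_eq (z w z' w' : C) : z = z' -> w = w' -> quat z w = quat z' w'.
Proof. by move=> -> ->. Qed.

Lemma quat10 : quat 1 0 = 1%:M.
Proof.
by apply/matrixP => -[[|[|//]] ?] [[|[|//]] ?]; rewrite !mxE/= ?conjC0 ?oppr0 ?conjC1.
Qed.

Lemma quatM z w z' w' :
  quat z w *m quat z' w' = quat (z * z' - w * w'^*) (z * w' + w * z'^*).
Proof.
apply/matrixP => -[[|[|//]] ?] [[|[|//]] ?]; rewrite !mxE !big_ord_recl big_ord0 !mxE /=;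
  rewrite ?(rmorphD, rmorphN, rmorphM) /= ?conjCK; ring.
Qed.

Lemma quat_trC z w : (quat z w) ^t* = quat z^* (- w).
Proof.
by apply/matrixP => -[[|[|//]] ?] [[|[|//]] ?];
  rewrite !mxE /= ?rmorphN /= ?conjCK ?opprK.
Qed.

Lemma det_quat z w : \det (quat z w) = z * z^* + w * w^*.
Proof.
rewrite (expand_det_row _ ord0) !big_ord_recl big_ord0 /cofactor !det_mx11 !mxE /=.
by rewrite expr0 expr1; ring.
Qed.

Lemma is_SU_quat z w : z * z^* + w * w^* = 1 -> is_SU (quat z w).
Proof.
move=> zw; split; last by rewrite det_quat.
apply/unitarymxP; rewrite quat_trC quatM rmorphN /= conjCK -quat10.
by apply: quat_eq; rewrite -?zw; ring.
Qed.

Lemma l1_quatB z w z' w' :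
  l1 (quat z w - quat z' w') = 2 * cabs (z - z') + 2 * cabs (w - w').
Proof.
rewrite /l1 !big_ord_recl !big_ord0 !mxE /= -opprD -!rmorphB cabsN !cabs_conj.
ring.
Qed.

Section commutators.
Variable e : R.
Hypotheses (e_ge0 : 0 <= e) (e_le1 : e <= 1).

(* For the unit quaternions [a = c + s j] and [b = c + s k] with [2 s^2 = - y],
   the commutator of [a] and [b] is [p^*] up to third order in [s]. *)
Lemma quat_commutator_npos (p : C) : cabs p = 1 -> cabs (p - 1) <= e ^+ 2 ->
  complex.Im p <= 0 -> exists a b, [/\ is_SU a, is_SU b,
    l1 (a - 1%:M) <= 4 * e, l1 (b - 1%:M) <= 4 * e &
    l1 (quat p^* 0 - a *m b *m (b *m a) ^t*) <= 12 * e ^+ 3].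
Proof.
move=> p1 pe y0; set x := complex.Re p; set y := complex.Im p in y0.
have pE : p = (x +i* y)%C by rewrite /x /y; case: (p).
have xy : x ^+ 2 + y ^+ 2 = 1 by rewrite -cabs_sqr p1 expr1n.
have e2 : e ^+ 2 <= e by rewrite expr2 ler_piMr.
have e22 : 0 <= e ^+ 2 by exact: sqr_ge0.
have ye : - y <= e ^+ 2.
  have := le_trans (Im_le_cabs _) pe; rewrite ImD ImN -/y /= oppr0 addr0.
  by apply: le_trans; rewrite ler_normr lexx orbT.
have x1 : 2 - 2 * x <= e ^+ 4.
  have : cabs (p - 1) ^+ 2 <= (e ^+ 2) ^+ 2.
    by rewrite ler_sqr ?nnegrE ?cabs_ge0.
  rewrite cabs_sqr ReD ImD ReN ImN -/x -/y /= -exprM; nra.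
have x1' : x <= 1 by nra.
pose s := Num.sqrt (- y / 2).
have s2 : s ^+ 2 = - y / 2 by rewrite sqr_sqrtr// divr_ge0// oppr_ge0.
have s0 : 0 <= s by exact: sqrtr_ge0.
have se : s <= e by rewrite -ler_sqr ?nnegrE// s2; lra.
have s1 : s <= 1 by exact: le_trans se e_le1.
pose c := Num.sqrt (1 - s ^+ 2).
have s21 : s ^+ 2 <= s by rewrite expr2 ler_piMr.
have c2 : c ^+ 2 = 1 - s ^+ 2 by rewrite sqr_sqrtr//; lra.
have c0 : 0 <= c by exact: sqrtr_ge0.
have c1 : c <= 1 by rewrite -ler_sqr ?nnegrE// expr1n c2; lra.
have cs : 1 - c <= s by nra.
have a1 (w : C) : cabs w = s -> l1 (quat c%:C%C w - 1%:M) <= 4 * e.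
  move=> ws; rewrite -quat10 l1_quatB subr0 ws -rmorphB cabs_real distrC ger0_norm ?subr_ge0//.
  lra.
exists (quat c%:C%C s%:C%C), (quat c%:C%C (0 +i* s)%C); split.
- apply: is_SU_quat; rewrite !conjC_real -!rmorphM -rmorphD /= -!expr2 c2.
  by rewrite subrK.
- apply: is_SU_quat; rewrite conjC_real -!expr2.
  have -> : (0 +i* s)%C^* = (0 +i* - s)%C :> C by [].
  by apply/eqP; rewrite eq_complex /=; apply/andP; split; apply/eqP; nra.
- by apply: a1; rewrite cabs_real ger0_norm.
- apply: a1; apply/eqP; rewrite -(eqrXn2 (_ : 0 < 2)%N) ?cabs_ge0// cabs_sqr /=.
  by rewrite expr0n add0r.
have s3 : s ^+ 3 <= e ^+ 3 by rewrite lerXn2r.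
have s4 : s ^+ 4 <= e ^+ 3.
  by apply: le_trans s3; rewrite exprS ler_piMl ?exprn_ge0.
have e4 : e ^+ 4 <= e ^+ 3 by rewrite exprS ler_piMl ?exprn_ge0.
pose z := ((1 - 2 * s ^+ 4) +i* (2 * s ^+ 2 - 2 * s ^+ 4))%C : C.
pose w := ((2 * c * s ^+ 3) +i* (- 2 * c * s ^+ 3))%C : C.
have -> : quat c%:C%C s%:C%C *m quat c%:C%C (0 +i* s)%C
  *m (quat c%:C%C (0 +i* s)%C *m quat c%:C%C s%:C%C) ^t* = quat z w.
  rewrite !quatM quat_trC quatM.
  have s4E : s ^+ 4 = s ^+ 2 * s ^+ 2 by rewrite -exprD.
  have c4E : c ^+ 2 * c ^+ 2 = (1 - s ^+ 2) * (1 - s ^+ 2) by rewrite c2.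
  by apply: quat_eq; apply/eqP; rewrite eq_complex /z /w /=; apply/andP; split; apply/eqP;
    rewrite ?s4E; nra.
rewrite l1_quatB sub0r cabsN.
have h1 : cabs (p^* - z) <= 2 * e ^+ 3.
  rewrite (le_trans (cabs_le_ReIm _))// pE /z /=.
  rewrite (_ : x + - (1 - 2 * s ^+ 4) = 2 * s ^+ 4 - (1 - x)); last ring.
  rewrite (_ : - y + - (2 * s ^+ 2 - 2 * s ^+ 4) = 2 * s ^+ 4); last by rewrite s2; field.
  have s4' : s ^+ 4 <= e ^+ 4 / 4.
    have s2e : s ^+ 2 <= e ^+ 2 / 2 by rewrite s2; lra.
    rewrite (_ : s ^+ 4 = s ^+ 2 * s ^+ 2); last by rewrite -exprD.
    rewrite (_ : e ^+ 4 / 4 = (e ^+ 2 / 2) * (e ^+ 2 / 2)); last by field.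
    by rewrite ler_pM ?sqr_ge0.
  have s40 : 0 <= s ^+ 4 by exact: exprn_ge0.
  have : `|2 * s ^+ 4 - (1 - x)| <= e ^+ 3 by rewrite ler_norml; lra.
  have : `|2 * s ^+ 4| <= e ^+ 3 by rewrite ler_norml; lra.
  lra.
have h2 : cabs w <= 4 * e ^+ 3.
  have cs3 : c * s ^+ 3 <= e ^+ 3.
    by apply: le_trans s3; rewrite ler_piMl ?exprn_ge0.
  have cs30 : 0 <= c * s ^+ 3 by rewrite mulr_ge0 ?exprn_ge0.
  rewrite (le_trans (cabs_le_ReIm _))// /w /=.
  rewrite (_ : - 2 * c * s ^+ 3 = - (2 * c * s ^+ 3)); last ring.
  rewrite normrN -!mulrA ger0_norm; lra.
lra.
Qed.

Lemma quat_commutator (p : C) : cabs p = 1 -> cabs (p - 1) <= e ^+ 2 ->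
  exists a b, [/\ is_SU a, is_SU b,
    l1 (a - 1%:M) <= 4 * e, l1 (b - 1%:M) <= 4 * e &
    l1 (quat p^* 0 - a *m b *m (b *m a) ^t*) <= 12 * e ^+ 3].
Proof.
move=> p1 pe; have [y0|y0] := leP (complex.Im p) 0.
  exact: quat_commutator_npos.
have [|||a [b [Sa Sb ae be abe]]] := @quat_commutator_npos p^*.
- by rewrite cabs_conj.
- by rewrite -[1]conjC1 -rmorphB cabs_conj.
- by case: p y0 {p1 pe} => ? ? /=; rewrite oppr_le0 => /ltW.
exists b, a; split; [exact: Sb|exact: Sa|exact: be|exact: ae|].
rewrite -l1_trC trCD trCN quat_trC oppr0.
by rewrite (trCM (b *m a)) trmxCK.
Qed.

End commutators.

End special_unitary.

(** * Almost dense subgroups of SU *)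

Section rigidity.
Variable R : realType.
Local Notation C := R[i].

Definition SU_subgroup m (Q : set 'M[C]_m) := [/\ Q 1%:M,
  forall A, Q A -> is_SU A,
  forall A B, Q A -> Q B -> Q (A *m B) & forall A, Q A -> Q (A ^t*)].

Definition dense_in_SU m (Q : set 'M[C]_m) (r : R) :=
  forall A, is_SU A -> exists2 q, Q q & l1 (A - q) <= r.

Section dimension.
Variable n : nat.
Local Notation m := n.+1.

Let k : R := (m * m)%:R.
Let k_ge1 : 1 <= k. Proof. by rewrite ler1n muln_gt0. Qed.

Definition block (i : 'I_n) : 'M[C]_(m, 2) :=
  \matrix_(a, b) (a == (if b == 0 then ord0 else lift ord0 i))%:R.

Lemma block_isometry i : (block i) ^t* *m block i = 1%:M.
Proof.
apply/matrixP => a b; rewrite !mxE.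
under eq_bigr do rewrite !mxE conjC_nat.
rewrite (bigD1 (if b == 0 then ord0 else lift ord0 i))//= eqxx mulr1.
rewrite big1 ?addr0; last by move=> j /negPf ->; rewrite mulr0.
by case: a b => -[|[|//]] ? [[|[|//]] ?]; rewrite /= ?eqxx.
Qed.

Lemma l1_block i : l1 (block i) <= (m * 2)%:R.
Proof.
rewrite -[leRHS]mulr1; apply: l1_le_entry => a b; rewrite mxE.
by case: (_ == _); rewrite ?cabs1 ?cabs0.
Qed.

Lemma emb_block_diag i z : emb (block i) (quat z^* 0) =
  diag_mx (\row_j if j == ord0 then z^* else if j == lift ord0 i then z else 1).
Proof.
apply/matrixP => a b.
rewrite !mxE !big_ord_recl !big_ord0 !mxE !big_ord_recl !big_ord0 !mxE /=.
rewrite conjC0 oppr0 conjCK !conjC_nat.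
have [->|a0] := eqVneq a ord0.
  have [->|b0] := eqVneq b ord0; rewrite /= ?eqxx ?mulr1n ?mulr0n; ring.
have [->|ai] := eqVneq a (lift ord0 i).
  have [->|bi] := eqVneq b (lift ord0 i); rewrite /= ?eqxx ?mulr1n ?mulr0n.
    ring.
  ring.
by have [_|_] := eqVneq a b; rewrite ?mulr1n ?mulr0n; ring.
Qed.

Lemma commutator_perturbation (a b a' b' : 'M[C]_m) (c e : R) :
  [/\ a \is unitarymx, b \is unitarymx, a' \is unitarymx & b' \is unitarymx] ->
  0 <= c -> 0 <= e -> e <= 1 ->
  l1 (a - 1%:M) <= c * e -> l1 (b - 1%:M) <= c * e ->
  l1 (a - a') <= e ^+ 2 -> l1 (b - b') <= e ^+ 2 ->
  l1 (a *m b *m (b *m a) ^t* - a' *m b' *m (b' *m a') ^t*)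
    <= (2 * k * (2 * c + 1) + 4 * k * (c + 1) ^+ 2) * e ^+ 3.
Proof.
move=> [ua ub ua' ub'] c0 e0 e1 a1 b1 aa' bb'.
have e2e : e ^+ 2 <= e by rewrite expr2 ler_piMr.
have comm1 (x y : 'M[C]_m) : x *m y - y *m x =
    (x - 1%:M) *m (y - 1%:M) - (y - 1%:M) *m (x - 1%:M).
  rewrite !mulmxBl !mulmxBr !mulmx1 !mul1mx.
  by move: (x *m y) (y *m x) => X Y; apply/matrixP => i j; rewrite !mxE; ring.
have uYE (x y : 'M[C]_m) : x \is unitarymx -> y \is unitarymx ->
    x *m y *m (y *m x) ^t* = 1%:M + (x *m y - y *m x) *m (y *m x) ^t*.
  move=> ux uy; rewrite mulmxBl (unitary_mulmxV (unitaryM uy ux)).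
  by rewrite addrC subrK.
rewrite !uYE// opprD addrACA subrr add0r.
set D := a *m b - _; set D' := a' *m b' - _; set Y := b *m a; set Y' := b' *m a'.
have l1a' : l1 (a' - 1%:M) <= (c + 1) * e.
  rewrite (le_trans (l1_triangle a _ _))// l1BC; lra.
have l1b' : l1 (b' - 1%:M) <= (c + 1) * e.
  rewrite (le_trans (l1_triangle b _ _))// l1BC; lra.
have prod_bound (x y x' y' : 'M[C]_m) : l1 y <= c * e -> l1 x' <= (c + 1) * e ->
    l1 (x - x') <= e ^+ 2 -> l1 (y - y') <= e ^+ 2 ->
    l1 (x *m y - x' *m y') <= (2 * c + 1) * e ^+ 3.
  move=> hy hx' hx hxy; rewrite (le_trans (l1_mulB _ _ _ _))//.
  have h1 : l1 (x - x') * l1 y <= e ^+ 2 * (c * e) by rewrite ler_pM ?l1_ge0.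
  have h2 : l1 x' * l1 (y - y') <= (c + 1) * e * e ^+ 2 by rewrite ler_pM ?l1_ge0.
  rewrite exprS; nra.
have sub1 (x y : 'M[C]_m) : (x - 1%:M) - (y - 1%:M) = x - y.
  by rewrite opprB addrA subrK.
have DD' : l1 (D - D') <= 2 * (2 * c + 1) * e ^+ 3.
  have -> : D - D' = ((a - 1%:M) *m (b - 1%:M) - (a' - 1%:M) *m (b' - 1%:M))
      - ((b - 1%:M) *m (a - 1%:M) - (b' - 1%:M) *m (a' - 1%:M)).
    rewrite /D /D' (comm1 a) (comm1 a').
    move: (_ *m _) (_ *m _) (_ *m _) (_ *m _) => x1 x2 x3 x4.
    by apply/matrixP => i j; rewrite !mxE; ring.
  rewrite (le_trans (l1B _ _))//.
  have aa1 : l1 ((a - 1%:M) - (a' - 1%:M)) <= e ^+ 2 by rewrite sub1.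
  have bb1 : l1 ((b - 1%:M) - (b' - 1%:M)) <= e ^+ 2 by rewrite sub1.
  apply: le_trans (lerD (prod_bound _ _ _ _ b1 l1a' aa1 bb1)
    (prod_bound _ _ _ _ a1 l1b' bb1 aa1)) _.
  by rewrite -mulrA [leRHS]mulr_natl mulr2n.
have lD' : l1 D' <= 2 * (c + 1) ^+ 2 * e ^+ 2.
  rewrite /D' comm1 (le_trans (l1B _ _))//.
  have h1 := l1M (a' - 1%:M) (b' - 1%:M); have h2 := l1M (b' - 1%:M) (a' - 1%:M).
  have h3 : l1 (a' - 1%:M) * l1 (b' - 1%:M) <= (c + 1) * e * ((c + 1) * e).
    by rewrite ler_pM ?l1_ge0.
  rewrite (_ : 2 * (c + 1) ^+ 2 * e ^+ 2 = (c + 1) * e * ((c + 1) * e) *+ 2).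
    by rewrite mulr2n lerD// (le_trans h1, le_trans h2)// mulrC.
  ring.
have YY' : l1 (Y ^t* - Y' ^t*) <= 2 * k * e.
  rewrite -trCN -trCD l1_trC (le_trans (l1_mulB _ _ _ _))//.
  have h1 : l1 (b - b') * l1 a <= e * k.
    by rewrite ler_pM ?l1_ge0 ?l1_unitary// (le_trans bb').
  have h2 : l1 b' * l1 (a - a') <= k * e.
    by rewrite ler_pM ?l1_ge0 ?l1_unitary// (le_trans aa').
  lra.
rewrite (le_trans (l1_mulB _ _ _ _))//.
have h1 : l1 (D - D') * l1 (Y ^t*) <= 2 * (2 * c + 1) * e ^+ 3 * k.
  apply: (ler_pM (l1_ge0 _) (l1_ge0 _) DD'); rewrite l1_trC.
  exact: l1_unitary (unitaryM ub ua).
have h2 : l1 D' * l1 (Y ^t* - Y' ^t*) <= 2 * (c + 1) ^+ 2 * e ^+ 2 * (2 * k * e).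
  by rewrite ler_pM ?l1_ge0.
rewrite (_ : e ^+ 3 = e ^+ 2 * e) in h1 *; last by rewrite -exprSr.
lra.
Qed.

End dimension.

End rigidity.

Section density_improvement.
Variables (R : realType) (n : nat).
Local Notation C := R[i].
Local Notation m := n.+1.

Let k : R := (m * m)%:R.
Let k_ge1 : 1 <= k. Proof. by rewrite ler1n muln_gt0. Qed.
Let k_ge0 : 0 <= k. Proof. by rewrite ler0n. Qed.
Let b : R := k * k * ((m * 2)%:R * (m * 2)%:R).
Let b_ge0 : 0 <= b. Proof. by rewrite !mulr_ge0. Qed.

Let el (V : 'M[C]_m) (i : 'I_n) (A : 'M[C]_2) := V ^t* *m emb (block R i) A *m V.

Let l1_elB V i A B : V \is unitarymx -> l1 (el V i A - el V i B) <= b * l1 (A - B).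
Proof.
move=> uV; rewrite /el -mulmxBl -mulmxBr.
apply: le_trans (l1_unitaryMr _ uV) _.
have h1 := l1_unitaryMl (emb (block R i) A - emb (block R i) B) (unitaryV uV).
have h2 := l1_embB (block R i) A B.
have h3 : l1 (block R i) * l1 (block R i) <= (m * 2)%:R * (m * 2)%:R.
  by apply: ler_pM; rewrite ?l1_ge0// l1_block.
rewrite /b -!mulrA ler_wpM2l// (le_trans h1)// ler_wpM2l// mulrA (le_trans h2)//.
by rewrite ler_wpM2r ?l1_ge0.
Qed.

Let elM V i A B : V \is unitarymx -> el V i (A *m B) = el V i A *m el V i B.
Proof.
move=> uV; rewrite /el embM; last exact: block_isometry.
by rewrite !mulmxA mulmxtVK// mulmxA.
Qed.

Let el_trC V i A : el V i A ^t* = el V i (A ^t*).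
Proof. by rewrite /el !trCM trmxCK emb_trC mulmxA. Qed.

Let el1 V i : V \is unitarymx -> el V i 1%:M = 1%:M.
Proof. by move=> uV; rewrite /el emb1 mulmx1 unitary_mulVmx. Qed.

Let el_SU V i A : V \is unitarymx -> is_SU A -> is_SU (el V i A).
Proof.
move=> uV SA; apply: (is_SU_conj uV); apply: is_SU_emb SA.
exact: block_isometry.
Qed.

Let K : R := 12 * b + (2 * k * (2 * (4 * b) + 1) + 4 * k * (4 * b + 1) ^+ 2).

Let K_ge1 : 1 <= K.
Proof.
have h : 0 <= k * (4 * b + 1) ^+ 2 by rewrite mulr_ge0// sqr_ge0.
have h2 : 0 <= k * b by exact: mulr_ge0.
rewrite /K -(mulrA 4 k); move: (k * (4 * b + 1) ^+ 2) h => z z0.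
have -> : 2 * k * (2 * (4 * b) + 1) = 16 * (k * b) + 2 * k by ring.
move: (k * b) h2 => kb kb0.
have := k_ge1; have := b_ge0; lra.
Qed.

Lemma torus_approx (Q : set 'M[C]_m) (r e : R) (V : 'M[C]_m)
    (i : 'I_n) (p : C) :
  SU_subgroup Q -> dense_in_SU Q r -> r <= e ^+ 2 -> 0 <= e -> e <= 1 ->
  V \is unitarymx -> cabs p = 1 -> cabs (p - 1) <= e ^+ 2 ->
  exists2 q, Q q & l1 (V ^t* *m emb (block R i) (quat p^* 0) *m V - q) <= K * e ^+ 3.
Proof.
move=> [Q1 Qu QM QV] Qd re e0 e1 uV p1 pe.
have [a2 [b2 [Sa Sb a1 b1 ab]]] := quat_commutator e0 e1 p1 pe.
have SA := el_SU i uV Sa; have SB := el_SU i uV Sb.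
have [a' Qa' aa'] := Qd _ SA; have [b' Qb' bb'] := Qd _ SB.
have small c2 : l1 (c2 - 1%:M) <= 4 * e -> l1 (el V i c2 - 1%:M) <= 4 * b * e.
  move=> h; rewrite -(el1 i uV); apply: le_trans (l1_elB i _ _ uV) _.
  by rewrite [4 * b]mulrC -(mulrA b) ler_wpM2l.
exists (a' *m b' *m (b' *m a') ^t*).
  by apply: (QM _ _ (QM _ _ Qa' Qb')); apply/QV/QM.
have elE : el V i a2 *m el V i b2 *m (el V i b2 *m el V i a2) ^t* =
    el V i (a2 *m b2 *m (b2 *m a2) ^t*).
  by rewrite (elM i _ ((b2 *m a2) ^t*) uV) (elM i a2 b2 uV) -el_trC (elM i b2 a2 uV).
apply: le_trans (l1_triangle (el V i (a2 *m b2 *m (b2 *m a2) ^t*)) _ _) _.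
rewrite /K [leRHS]mulrDl; apply: lerD.
  apply: le_trans (l1_elB i _ _ uV) _.
  by rewrite [12 * b]mulrC -(mulrA b) ler_wpM2l.
have b40 : 0 <= 4 * b by rewrite mulr_ge0.
rewrite -elE; apply: (commutator_perturbation _ b40 e0 e1 (small _ a1) (small _ b1)
  (le_trans aa' re) (le_trans bb' re)).
by split; [exact: SA.1|exact: SB.1|exact: (Qu _ Qa').1|exact: (Qu _ Qb').1].
Qed.

Lemma product_approx (Q : set 'M[C]_m) (I : Type) (s : seq I) (F : I -> 'M[C]_m) (d : R) :
  SU_subgroup Q -> 0 <= d -> (forall i, F i \is unitarymx) ->
  (forall i, exists2 q, Q q & l1 (F i - q) <= d) ->
  exists2 q, Q q & l1 (\big[mulmx/1%:M]_(i <- s) F i - q) <= (2 * k) ^+ size s * d.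
Proof.
move=> [Q1 Qu QM QV] d0 Fu Fq; elim: s => [|i s [q Qq hq]].
  by exists 1%:M; rewrite // big_nil subrr l1_0 expr0 mul1r.
have [q1 Qq1 hq1] := Fq i; exists (q1 *m q); first exact: QM.
rewrite big_cons.
have -> : forall X, F i *m X - q1 *m q = F i *m (X - q) + (F i - q1) *m q.
  by move=> X; rewrite mulmxBl mulmxBr addrA subrK.
set X := \big[_/_]_(_ <- _) _ in hq *.
have h1 := l1_unitaryMl (X - q) (Fu i).
have h2 := l1_unitaryMr (F i - q1) (Qu _ Qq).1.
have h3 : k * l1 (X - q) <= k * ((2 * k) ^+ size s * d) by rewrite ler_wpM2l.
have h4 : k * l1 (F i - q1) <= k * d by rewrite ler_wpM2l.
have h5 : k * d <= k * ((2 * k) ^+ size s * d).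
  rewrite ler_wpM2l// ler_peMl// exprn_ege1//; have := k_ge1; lra.
apply: le_trans (l1D _ _) _; rewrite -/k in h1 h2.
rewrite exprS; move: ((2 * k) ^+ size s) h3 h5 => y h3 h5. lra.
Qed.

Lemma diag_product (d : 'rV[C]_m) : (forall j, d 0 j * (d 0 j)^* = 1) ->
  \prod_j d 0 j = 1 ->
  diag_mx d = \big[mulmx/1%:M]_(i : 'I_n)
    emb (block R i) (quat (d 0 (lift ord0 i))^* 0).
Proof.
move=> dd dprod; under eq_bigr do rewrite emb_block_diag.
have bigdiag (s : seq 'I_n) (f : 'I_n -> 'rV[C]_m) :
    \big[mulmx/1%:M]_(i <- s) diag_mx (f i) = diag_mx (\row_j \prod_(i <- s) f i 0 j).
  elim: s => [|i s IHs].
    rewrite big_nil -diag_const_mx; congr diag_mx.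
    by apply/rowP => j; rewrite !mxE big_nil.
  rewrite big_cons IHs mulmx_diag; congr diag_mx.
  by apply/rowP => j; rewrite !mxE big_cons.
rewrite bigdiag; congr diag_mx; apply/rowP => j; rewrite mxE.
under eq_bigr do rewrite mxE.
have [->|j0] := eqVneq j ord0.
  rewrite -rmorph_prod; move: dprod; rewrite big_ord_recl.
  set P := \prod_(i < n) _ => dP.
  have PP : P * P^* = 1.
    by rewrite /P rmorph_prod -big_split /=; apply: big1 => i _.
  by rewrite -[LHS]mulr1 -PP mulrA dP mul1r.
case: (unliftP ord0 j) j0 => [i ->|-> /eqP//] _.
rewrite (bigD1 i)//= eqxx big1 ?mulr1// => i' i'i.
by rewrite (inj_eq lift_inj) eq_sym (negPf i'i).
Qed.

Lemma conj_bigmul p (V : 'M[C]_p) (I : Type) (s : seq I) (f : I -> 'M[C]_p) :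
  V \is unitarymx -> V ^t* *m \big[mulmx/1%:M]_(i <- s) f i *m V =
  \big[mulmx/1%:M]_(i <- s) (V ^t* *m f i *m V).
Proof.
move=> uV; elim: s => [|i s IHs].
  by rewrite !big_nil mulmx1 (unitary_mulVmx uV).
rewrite !big_cons -IHs; set X := \big[_/_]_(_ <- _) _.
rewrite -[RHS]mulmxA [V *m (V ^t* *m X *m V)]mulmxA [V *m (V ^t* *m X)]mulmxA.
by rewrite (unitary_mulmxV uV) mul1mx !mulmxA.
Qed.

Lemma near1_approx (Q : set 'M[C]_m) (r e : R) (x : 'M[C]_m) :
  SU_subgroup Q -> dense_in_SU Q r -> r <= e ^+ 2 -> 0 <= e -> e <= 1 ->
  is_SU x -> k * k * l1 (x - 1%:M) <= e ^+ 2 ->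
  exists2 q, Q q & l1 (x - q) <= (2 * k) ^+ n * (K * e ^+ 3).
Proof.
move=> QG Qd re e0 e1 [ux dx] x1.
pose V := spectralmx x; pose d := spectral_diag x.
have uV : V \is unitarymx by exact: spectral_unitarymx.
have xE : x = V ^t* *m diag_mx d *m V.
  rewrite -(invmx_unitary uV); apply/orthomx_spectralP/normalmxP.
  by rewrite (unitary_mulmxV ux) (unitary_mulVmx ux).
have DE : diag_mx d = V *m x *m V ^t*.
  rewrite xE !mulmxA (unitary_mulmxV uV) mul1mx.
  by rewrite -mulmxA (unitary_mulmxV uV) mulmx1.
have uD : diag_mx d \is unitarymx.
  rewrite DE; exact: unitaryM (unitaryM uV ux) (unitaryV uV).
have dd j : d 0 j * (d 0 j)^* = 1.
  have /matrixP/(_ j j) := unitary_mulmxV uD.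
  by rewrite mul_diag_mx !mxE eqxx !mulr1n.
have dprod : \prod_j d 0 j = 1.
  rewrite -det_diag DE !det_mulmx dx mulr1 -det_mulmx.
  by rewrite (unitary_mulmxV uV) det1.
have d1 j : cabs (d 0 j - 1) <= e ^+ 2.
  apply: le_trans x1; apply: (@le_trans _ _ (l1 (diag_mx d - 1%:M))).
    by have := entry_le_l1 (diag_mx d - 1%:M) j j; rewrite !mxE eqxx !mulr1n.
  have -> : diag_mx d - 1%:M = V *m (x - 1%:M) *m V ^t*.
    by rewrite mulmxBr mulmx1 mulmxBl -DE (unitary_mulmxV uV).
  apply: le_trans (l1_unitaryMr _ (unitaryV uV)) _.
  by rewrite -mulrA ler_wpM2l//; exact: l1_unitaryMl uV.
have dabs j : cabs (d 0 j) = 1.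
  apply/eqP; rewrite -(eqrXn2 (_ : 0 < 2)%N) ?cabs_ge0// expr1n.
  by apply/eqP/complexI; rewrite rmorphXn /= cabsE normCK dd.
pose F i := el V i (quat (d 0 (lift ord0 i))^* 0).
have -> : x = \big[mulmx/1%:M]_(i <- index_enum 'I_n) F i.
  rewrite xE (diag_product dd dprod).
  exact: conj_bigmul uV.
have := @product_approx Q _ (index_enum 'I_n) F (K * e ^+ 3) QG.
have -> : size (index_enum 'I_n) = n by rewrite [index_enum _]unlock -enumT size_enum_ord.
apply.
- by rewrite mulr_ge0 ?exprn_ge0// (le_trans ler01).
- move=> i; apply: (el_SU i uV _).1; apply: is_SU_quat.
  by rewrite conjCK mul0r addr0 mulrC.
- move=> i; exact: torus_approx Qd re e0 e1 uV (dabs _) (d1 _).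
Qed.

Lemma density_halving : exists2 r0 : R, 0 < r0 &
  forall (Q : set 'M[C]_m) r, SU_subgroup Q -> 0 < r -> r <= r0 ->
    dense_in_SU Q r -> dense_in_SU Q (r / 2).
Proof.
pose L := 2 * k ^+ 4 * ((2 * k) ^+ n * K).
have k4 : 1 <= k ^+ 4 by rewrite exprn_ege1.
have kn : 1 <= (2 * k) ^+ n by rewrite exprn_ege1//; have := k_ge1; lra.
have L1 : 1 <= L.
  rewrite /L; have : 1 <= (2 * k) ^+ n * K by rewrite mulr_ege1.
  by move: (_ * K) => z z1; rewrite mulr_ege1// mulr_ege1// ler1n.
have L0 : 0 < L by rewrite (lt_le_trans ltr01).
have k3 : 0 < k ^+ 3 by rewrite exprn_gt0// (lt_le_trans ltr01).
exists (L ^- 2 / k ^+ 3); first by rewrite divr_gt0// invr_gt0 exprn_gt0.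
move=> Q r QG r_gt0; rewrite ler_pdivlMr// => rL Qd x Sx.
have [Q1 Qu QM QV] := QG.
pose e := Num.sqrt (r * k ^+ 3).
have e2 : e ^+ 2 = r * k ^+ 3 by rewrite sqr_sqrtr// mulr_ge0// ltW.
have e0 : 0 <= e by exact: sqrtr_ge0.
have eL : e <= L^-1.
  rewrite -ler_sqr ?nnegrE ?invr_ge0 ?(ltW L0)// e2.
  by rewrite -exprVn in rL.
have e1 : e <= 1 by rewrite (le_trans eL)// invf_le1.
have re : r <= e ^+ 2.
  by rewrite e2 ler_peMr ?(ltW r_gt0)// exprn_ege1.
have [q Qq xq] := Qd x Sx.
have Sy : is_SU (q ^t* *m x) by apply: is_SUM Sx; exact/is_SU_trC/Qu.
have [|q' Qq' h] := @near1_approx Q r e (q ^t* *m x) QG Qd re e0 e1 Sy.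
  have -> : q ^t* *m x - 1%:M = q ^t* *m (x - q).
    by rewrite mulmxBr (unitary_mulVmx (Qu _ Qq).1).
  have := l1_unitaryMl (x - q) (unitaryV (Qu _ Qq).1); rewrite -/k => h.
  rewrite e2 (_ : r * k ^+ 3 = k * k * (k * r)); last by ring.
  by rewrite ler_wpM2l ?mulr_ge0// (le_trans h)// ler_wpM2l.
exists (q *m q'); first exact: QM.
have -> : x - q *m q' = q *m (q ^t* *m x - q').
  by rewrite mulmxBr mulmxA (unitary_mulmxV (Qu _ Qq).1) mul1mx.
apply: le_trans (l1_unitaryMl _ (Qu _ Qq).1) _; rewrite -/k.
apply: (@le_trans _ _ (k * ((2 * k) ^+ n * (K * e ^+ 3)))); first by rewrite ler_wpM2l.
have eL1 : L * e <= 1 by rewrite -ler_pdivlMl// mulr1.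
have -> : k * ((2 * k) ^+ n * (K * e ^+ 3)) = r / 2 * (L * e).
  by rewrite exprSr e2 /L; move: ((2 * k) ^+ n) => y; field.
by rewrite ler_piMr// divr_ge0// ltW.
Qed.

Lemma dense_in_SU_approx : exists2 r0 : R, 0 < r0 &
  forall Q : set 'M[C]_m, SU_subgroup Q -> dense_in_SU Q r0 ->
    forall r, 0 < r -> dense_in_SU Q r.
Proof.
have [r0 r00 halve] := density_halving; exists r0 => // Q QG Qd r r_gt0.
have dj j : dense_in_SU Q (r0 / 2 ^+ j).
  elim: j => [|j IHj]; first by rewrite expr0 divr1.
  rewrite exprSr invfM mulrA; apply: halve => //.
    by rewrite divr_gt0// exprn_gt0.
  by rewrite ler_pdivrMr ?exprn_gt0// ler_peMr ?(ltW r00)// exprn_ege1// ler1n.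
move=> A SA; pose j := Num.truncn (r0 / r).
have [q Qq Aq] := dj j.+1 A SA; exists q => //; apply: (le_trans Aq).
have /andP[_ h] : j%:R <= r0 / r < j.+1%:R.
  by apply: truncn_itv; rewrite divr_ge0// ltW.
rewrite ler_pdivrMr ?exprn_gt0// mulrC -ler_pdivrMr// (le_trans (ltW h))//.
by rewrite -natrX ler_nat ltnW// ltn_expl.
Qed.

End density_improvement.

(** * Topology of SU(n) and of the product *)

Local Open Scope classical_set_scope.

Section special_unitary_topology.
Variables (R : realType) (n : nat).
Local Notation C := R[i].
Implicit Types x y : SU R n.

Lemma is_SU_val x : is_SU (su_mx x).
Proof. by case/andP: (su_mxP x) => ? /eqP. Qed.

Lemma is_SU_MkSU (A : 'M[C]_n) : is_SU A -> exists x : SU R n, su_mx x = A.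
Proof.
case=> uA dA; have SA : (A \is unitarymx) && (\det A == 1) by rewrite uA dA eqxx.
by exists (MkSU SA).
Qed.

Lemma SU_nbhs x (V : set (SU R n)) : nbhs x V <->
  exists2 e : R, 0 < e & forall y, l1 (su_mx y - su_mx x) < e -> V y.
Proof.
split=> [[W [[U oU <-] Ux UV]]|[e e0 eV]].
  have /nbhs_ballP[e /= e0 eU] : nbhs (su_mx x) U by exact: open_nbhs_nbhs.
  have eE : e = (complex.Re e)%:C%C by rewrite RRe_real// gtr0_real.
  exists (complex.Re e); first by rewrite -ltcR -eE.
  move=> y yx; apply/UV/eU; split=> // i j.
  suff : `|su_mx x i j - su_mx y i j| < e by [].
  rewrite eE -cabsE ltcR; apply: le_lt_trans yx; rewrite l1BC.
  by have := entry_le_l1 (su_mx x - su_mx y) i j; rewrite !mxE.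
pose e' : R := e / ((n * n)%:R + 1).
have e'0 : 0 < e' by rewrite divr_gt0// ltr_wpDl.
pose B := (ball (su_mx x) e'%:C%C)^°%classic.
exists (@su_mx R n @^-1` B); split.
- by exists B; [exact: open_interior|].
- by apply: nbhsx_ballx; rewrite ltcR.
move=> y /interior_subset[_ xy].
apply: eV; apply: (@le_lt_trans _ _ ((n * n)%:R * e')).
  apply: l1_le_entry => i j.
  have : `|su_mx x i j - su_mx y i j| < e'%:C%C by exact: xy.
  rewrite -cabsE ltcR !mxE => /ltW.
  by rewrite -cabsN opprB.
by rewrite /e' mulrA ltr_pdivrMr ?ltr_wpDl// mulrDr mulr1 mulrC ltrDl.
Qed.

Lemma lipschitz_SU_continuous (f : SU R n -> R) (c : R) :
  (forall x y, `|f x - f y| <= c * l1 (su_mx y - su_mx x)) -> continuous f.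
Proof.
move=> fc x V /nbhs_ballP[e /= e0 eV].
suff : nbhs x (f @^-1` V) by [].
apply/SU_nbhs; exists (e / (`|c| + 1)); first by rewrite divr_gt0// ltr_wpDl.
move=> y; rewrite ltr_pdivlMr ?ltr_wpDl// => h.
apply: eV; rewrite -ball_normE /=.
apply: le_lt_trans (fc _ _) _; apply: le_lt_trans h.
have := ler_norm c; have := l1_ge0 (su_mx y - su_mx x); nra.
Qed.

Lemma l1_dist_continuous (A : 'M[C]_n) : continuous (fun x => l1 (su_mx x - A)).
Proof.
apply: (@lipschitz_SU_continuous _ 1) => x y; rewrite mul1r.
have := l1_triangle (su_mx x) (su_mx y) A; have := l1_triangle (su_mx y) (su_mx x) A.
by rewrite [l1 (su_mx x - su_mx y)]l1BC ler_norml => ? ?; apply/andP; split; lra.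
Qed.

Lemma Retr_mul_continuous (A : 'M[C]_n) : continuous (fun x => Retr (A *m su_mx x)).
Proof.
apply: (@lipschitz_SU_continuous _ (l1 A)) => x y; rewrite -RetrB -mulmxBr l1BC.
exact: le_trans (Retr_le_l1 _) (l1M _ _).
Qed.

Lemma su_mxX x j : su_mx (x ^+ j)%g = iter j (mulmx (su_mx x)) 1%:M.
Proof. by elim: j => [//|j IHj]; rewrite expgS /= -IHj. Qed.

Lemma power_dist_continuous j : continuous (fun x => l1 (su_mx (x ^+ j)%g - 1%:M)).
Proof.
have [c hc] : exists c : R, forall x y,
    l1 (su_mx (y ^+ j)%g - su_mx (x ^+ j)%g) <= c * l1 (su_mx y - su_mx x).
  elim: j => [|j [c hc]].
    by exists 0 => x y; rewrite !expg0 subrr l1_0 mul0r.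
  exists ((n * n)%:R + (n * n)%:R * c) => x y; rewrite !expgS.
  apply: le_trans (l1_mulB _ _ _ _) _; rewrite mulrDl mulrC -mulrA lerD//.
    by rewrite ler_wpM2r ?l1_ge0// l1_unitary//; exact: (is_SU_val _).1.
  apply: ler_pM; rewrite ?l1_ge0 ?hc// l1_unitary//; exact: (is_SU_val _).1.
apply: (@lipschitz_SU_continuous _ c) => x y; apply: le_trans (hc x y).
have := l1_triangle (su_mx (x ^+ j)%g) (su_mx (y ^+ j)%g) 1%:M.
have := l1_triangle (su_mx (y ^+ j)%g) (su_mx (x ^+ j)%g) 1%:M.
rewrite [l1 (su_mx (x ^+ j)%g - _ (y ^+ j)%g)]l1BC ler_norml.
by move=> ? ?; apply/andP; split; lra.
Qed.

Lemma cabs_prodB (I : Type) (s : seq I) (f g : I -> C) :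
  (forall i, cabs (f i) <= 1) -> (forall i, cabs (g i) <= 1) ->
  cabs (\prod_(i <- s) f i - \prod_(i <- s) g i) <= \sum_(i <- s) cabs (f i - g i).
Proof.
move=> f1 g1; elim: s => [|i s IHs]; first by rewrite !big_nil subrr cabs0.
rewrite !big_cons.
have -> : forall X Y, f i * X - g i * Y = (f i - g i) * X + g i * (X - Y).
  by move=> X Y; ring.
apply: le_trans (cabsD _ _) _; rewrite !cabsM lerD//.
  rewrite ler_piMr ?cabs_ge0//.
  elim: (s) => [|j s' IH]; first by rewrite big_nil cabs1.
  by rewrite big_cons cabsM mulr_ile1 ?cabs_ge0.
by apply: le_trans IHs; rewrite ler_piMl ?cabs_ge0.
Qed.

Lemma cabs_detB (A B : 'M[C]_n) : A \is unitarymx -> B \is unitarymx ->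
  cabs (\det A - \det B) <= (#|{perm 'I_n}| * n)%:R * l1 (A - B).
Proof.
move=> uA uB; rewrite /determinant -sumrB.
apply: le_trans (cabs_sum _ _ _) _.
rewrite natrM -mulrA mulr_natl -sumr_const; apply: ler_sum => s _.
rewrite -mulrBr cabsM -(rmorph_sign (real_complex R)) cabs_real normr_sign mul1r.
apply: le_trans (cabs_prodB _ _ _) _ => [i|i|]; try exact: cabs_unitary.
rewrite -[n in n%:R]card_ord mulr_natl -sumr_const; apply: ler_sum => i _.
by have := entry_le_l1 (A - B) i (s i); rewrite !mxE.
Qed.

Lemma is_SU_closed (A : 'M[C]_n) :
  (forall e : R, 0 < e -> exists x, l1 (su_mx x - A) < e) -> is_SU A.
Proof.
move=> clA.
have eq0_small (z c : R) : 0 <= z -> 0 <= c ->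
    (forall e, 0 < e -> e <= 1 -> z <= c * e) -> z = 0.
  move=> z0 c0 h; apply/eqP; rewrite eq_le z0 andbT leNgt; apply/negP => zp.
  have c1 : 0 < 2 * (c + 1) by lra.
  have := h (Num.min 1 (z / (2 * (c + 1)))).
  rewrite lt_min ltr01 divr_gt0// ge_min lexx => /(_ isT isT).
  have : Num.min 1 (z / (2 * (c + 1))) <= z / (2 * (c + 1)).
    by rewrite ge_min lexx orbT.
  by rewrite ler_pdivlMr// => *; nra.
have uA : A \is unitarymx.
  apply/unitarymxP/eqP; rewrite -subr_eq0; apply/eqP/l1_0_eq.
  apply: (eq0_small _ (l1 A + (n * n)%:R)); rewrite ?l1_ge0 ?addr_ge0 ?l1_ge0//.
  move=> e e0 e1; have [x xA] := clA e e0.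
  have /unitary_mulmxV <- := (is_SU_val x).1.
  apply: le_trans (l1_mulB _ _ _ _) _; rewrite l1_trC l1BC -trCN -trCD l1_trC.
  rewrite [l1 (A - _)]l1BC.
  have h1 := l1_unitary (is_SU_val x).1.
  have h2 : l1 (su_mx x - A) * l1 A <= e * l1 A by rewrite ler_wpM2r ?l1_ge0// ltW.
  have h3 : l1 (su_mx x) * l1 (su_mx x - A) <= (n * n)%:R * e.
    by rewrite ler_pM ?l1_ge0// ltW.
  lra.
split=> //; apply/eqP; rewrite -subr_eq0; apply/eqP/cabs0_eq.
apply: (eq0_small _ (#|{perm 'I_n}| * n)%:R); rewrite ?cabs_ge0//.
move=> e e0 e1; have [x xA] := clA e e0.
rewrite -(is_SU_val x).2; apply: le_trans (cabs_detB uA (is_SU_val x).1) _.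
by rewrite ler_wpM2l// l1BC ltW.
Qed.

Lemma SU_compact : compact [set: SU R n].
Proof.
move=> F FF _.
pose I : finType := ('I_n * 'I_n * bool)%type.
pose f (x : SU R n) (a : I) : R := let z := su_mx x a.1.1 a.1.2 in
  if a.2 then complex.Re z else complex.Im z.
pose u (x : SU R n) : 'rV[R]_#|I| := \row_j f x (enum_val j).
pose A (_ : 'I_#|I|) : set R := `[-1, 1]%classic.
have cA : compact [set v : 'rV[R]_#|I| | forall i, A i (v ord0 i)].
  by apply: rV_compact => i; exact: segment_compact.
have FA : F (u @^-1` [set v : 'rV[R]_#|I| | forall i, A i (v ord0 i)]).
  apply: (@filterS _ F _ setT _ _ filterT) => x _ i; rewrite /A /= mxE in_itv /= -ler_norml.
  have xu := (is_SU_val x).1.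
  case: (enum_val i) => -[a b] [] /=; rewrite /f /=.
    by rewrite (le_trans (Re_le_cabs _))// cabs_unitary.
  by rewrite (le_trans (Im_le_cabs _))// cabs_unitary.
have [v [_ clv]] := cA (u @ F) _ FA.
pose L : 'M[C]_n := \matrix_(i, j)
  (v ord0 (enum_rank (i, j, true)) +i* v ord0 (enum_rank (i, j, false)))%C.
have cl (B : set (SU R n)) (e : R) : F B -> 0 < e ->
    exists2 x, B x & l1 (su_mx x - L) < e.
  move=> FB e0; pose c : R := 1 + (n * n)%:R * 2.
  have c0 : 0 < c by rewrite /c ltr_pwDl// mulr_ge0.
  have FuB : F (u @^-1` [set u x | x in B]).
    by apply: (@filterS _ F _ B _ _ FB) => x Bx; exists x.
  have vB : nbhs v (ball v (e / c)).
    by apply: (nbhsx_ballx v (e / c)); rewrite divr_gt0.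
  have [_ [[x Bx <-] [_ vx]]] := clv _ _ FuB vB.
  exists x => //; apply: (@le_lt_trans _ _ ((n * n)%:R * (2 * (e / c)))).
    apply: l1_le_entry => i j; rewrite !mxE (le_trans (cabs_le_ReIm _))//.
    rewrite mulr_natl mulr2n lerD// ltW//.
      have := vx ord0 (enum_rank (i, j, true)).
      by rewrite -ball_normE /= mxE enum_rankK /f /= ReD ReN distrC.
    have := vx ord0 (enum_rank (i, j, false)).
    by rewrite -ball_normE /= mxE enum_rankK /f /= ImD ImN distrC.
  by rewrite !mulrA ltr_pdivrMr// /c; lra.
have [|x xL] := @is_SU_MkSU L.
  apply: is_SU_closed => e e0; have [x _ xe] := cl setT e filterT e0.
  by exists x.
exists x; split=> // B V FB /SU_nbhs[e e0 eV].
have [y By ye] := cl B e FB e0.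
by exists y; split=> //; apply: eV; rewrite xL.
Qed.

End special_unitary_topology.

Section product_topology.
Variable R : realType.

Lemma coord_continuous_comp n (f : SU R n.+1 -> R) :
  continuous f -> continuous (fun x : prodSU R => f (x n)).
Proof.
move=> cf x; apply: (@continuous_comp _ _ _ (fun x : prodSU R => x n) f).
  exact: (@proj_continuous nat (fun n => SU R n.+1) n x).
exact: cf.
Qed.

Lemma prodSU_compact : compact [set: prodSU R].
Proof.
have := @tychonoff nat (fun n => SU R n.+1) (fun n => [set: SU R n.+1])
  (fun n => @SU_compact R n.+1).
congr compact; apply/seteqP; split=> x //=.
Qed.

Lemma coord_closed n (f : SU R n.+1 -> R) (c : R) :
  continuous f -> closed [set x : prodSU R | f (x n) <= c].
Proof.
move=> cf; apply: (@preimage_closed _ _ (fun x : prodSU R => f (x n)) [set r | r <= c]).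
  by move=> x _; exact: coord_continuous_comp.
exact: closed_le.
Qed.

Lemma su_eqP n (x y : SU R n) : l1 (su_mx x - su_mx y) <= 0 -> x = y.
Proof.
move=> h; apply: val_inj; apply/eqP; rewrite -subr_eq0; apply/eqP/l1_0_eq/eqP.
by rewrite eq_le l1_ge0 andbT.
Qed.

Lemma coord_eq_closed n (c : SU R n.+1) : closed [set x : prodSU R | x n = c].
Proof.
rewrite (_ : mkset _ = [set x : prodSU R | l1 (su_mx (x n) - su_mx c) <= 0]).
  exact: coord_closed (l1_dist_continuous (A := su_mx c)).
apply/seteqP; split=> x /=; last exact: su_eqP.
by move=> ->; rewrite subrr l1_0.
Qed.

Lemma coord_pow_closed n j : closed [set x : prodSU R | (x n ^+ j)%g = 1%g].
Proof.
rewrite (_ : mkset _ = [set x : prodSU R | l1 (su_mx (x n ^+ j)%g - 1%:M) <= 0]).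
  exact: coord_closed (@power_dist_continuous R n.+1 j).
apply/seteqP; split=> x /=; first by move=> ->; rewrite subrr l1_0.
by move=> h; apply: su_eqP.
Qed.

Lemma sum_continuous (T : topologicalType) (I : Type) (s : seq I) (f : I -> T -> R) :
  (forall i, continuous (f i)) -> continuous (fun x => \sum_(i <- s) f i x).
Proof.
move=> cf; elim: s => [|i s IHs] x.
  under eq_fun do rewrite big_nil; exact: cst_continuous.
by under eq_fun do rewrite big_cons; apply: continuousD; [exact: cf|exact: IHs].
Qed.

Lemma Retr_close_1 m (e : R) : 0 < e -> exists2 delta : R, 0 < delta &
  forall U : 'M[R[i]]_m, U \is unitarymx -> m%:R - delta < Retr U ->
    l1 (U - 1%:M) < e.
Proof.
move=> e0; pose e' : R := e / ((m * m)%:R + 1).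
have e'0 : 0 < e' by rewrite divr_gt0// ltr_wpDl.
exists (e' ^+ 2 / 2); first by rewrite divr_gt0// exprn_gt0.
move=> U uU h; apply: (@le_lt_trans _ _ ((m * m)%:R * e')); last first.
  by rewrite /e' mulrA ltr_pdivrMr ?ltr_wpDl// mulrDr mulr1 mulrC ltrDl.
apply: l1_le_entry => i j.
rewrite -ler_sqr ?nnegrE ?cabs_ge0 ?(ltW e'0)//.
apply: (@le_trans _ _ (2 * (m%:R - Retr U))); last lra.
rewrite -hs_dist_unitary// (bigD1 i)//= (bigD1 j)//= -addrA lerDl.
by rewrite addr_ge0// sumr_ge0// => ? _; rewrite ?sumr_ge0// => *; exact: sqr_ge0.
Qed.

End product_topology.

Section truncation.
Variables (R : realType) (M : nat).
Implicit Types x y : prodSU R.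

Definition trunc x : prodSU R := fun i => if (i < M)%N then x i else 1%g.

Definition blk x : 'M[R[i]]_(\sum_(i < M) i.+1) := \mxdiag_(i < M) su_mx (x i).

Lemma truncM x y : trunc (x * y)%g = (trunc x * trunc y)%g.
Proof.
apply: functional_extensionality_dep => i.
have prodE (a b : prodSU R) : (a * b)%g i = (a i * b i)%g by [].
by rewrite prodE /trunc prodE; case: ifP => //; rewrite mulg1.
Qed.

Lemma trunc1 : trunc 1%g = 1%g.
Proof.
by apply: functional_extensionality_dep => i; rewrite /trunc; case: ifP.
Qed.

Lemma truncV x : trunc (x^-1)%g = ((trunc x)^-1)%g.
Proof.
by apply: (mulgI (trunc x)); rewrite -truncM !mulgV trunc1.
Qed.

Lemma truncX x j : trunc (x ^+ j)%g = (trunc x ^+ j)%g.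
Proof.
elim: j => [|j IHj]; first by rewrite !expg0 trunc1.
by rewrite !expgS truncM IHj.
Qed.

Lemma blkM x y : blk (x * y)%g = blk x *m blk y.
Proof.
rewrite /blk mul_mxdiag_mxblock; apply: eq_mxblock => i j.
case: eqVneq => [<-|ij]; first by rewrite !conform_mx_id.
by rewrite mulmx0.
Qed.

Lemma blk_trC x : (blk x) ^t* = blk (x^-1)%g.
Proof.
rewrite tr_mxdiag; apply/matrixP => a b; rewrite !mxE.
move: (tagnat.sig2 a) (tagnat.sig2 b); move: (tagnat.sig1 a) (tagnat.sig1 b).
move=> i j u; case: eqVneq => [<-|_] v; last by rewrite !mxE conjC0.
by rewrite !conform_mx_id !mxE.
Qed.

Lemma blk1 : blk 1%g = 1%:M.
Proof. exact: mxdiagZ. Qed.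

Lemma blk_unitary x : blk x \is unitarymx.
Proof.
by apply/unitarymxP; rewrite blk_trC -blkM mulgV blk1.
Qed.

Lemma Retr_blk x : Retr (blk x) = \sum_(i < M) Retr (su_mx (x i)).
Proof. by rewrite /Retr mxtrace_mxdiag Re_sum. Qed.

Lemma blk_inj x y : blk x = blk y -> trunc x = trunc y.
Proof.
move=> /(eq_mxdiagP (fun i : 'I_M => su_mx (x i)) (fun i => su_mx (y i))) xy.
apply: functional_extensionality_dep => i; rewrite /trunc.
case: ifP => // iM; apply: val_inj; exact: xy (Ordinal iM).
Qed.

End truncation.

(** * Torsion in groups projecting onto SU(n) *)

Section coordinate_projection_onto_SU.
Variables (R : realType) (G : set (prodSU R)) (n : nat).
Hypothesis cG : compact G.
Hypothesis G1 : G 1%g.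
Hypothesis GM : forall x y, G x -> G y -> G (x * y)%g.
Hypothesis GV : forall x, G x -> G (x^-1)%g.
Hypothesis Gsurj : forall A : SU R n.+1, exists2 g, G g & g n = A.

Let N : set (prodSU R) := [set x | G x /\ x n = 1%g].

Let coordM (x y : prodSU R) i : (x * y)%g i = (x i * y i)%g. Proof. by []. Qed.
Let coordV (x : prodSU R) i : (x^-1)%g i = ((x i)^-1)%g. Proof. by []. Qed.
Let coordX (x : prodSU R) i j : (x ^+ j)%g i = (x i ^+ j)%g.
Proof. by elim: j => [|j IHj]; rewrite ?expg0// !expgS coordM IHj. Qed.

Let Retr_blk_continuous M (y : prodSU R) :
  continuous (fun x => Retr (blk M (y * x)%g)).
Proof.
under eq_fun do rewrite Retr_blk.
apply: sum_continuous => i.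
apply: (@coord_continuous_comp R i (fun z => Retr (su_mx (y i) *m su_mx z))).
exact: Retr_mul_continuous.
Qed.

(* The projection is an open map, by compactness of [G]. *)
Lemma lift_near1 M (e : R) : 0 < e -> exists2 eta : R, 0 < eta &
  forall A : SU R n.+1, l1 (su_mx A - 1%:M) < eta ->
    exists h, [/\ G h, h n = A & (\sum_(i < M) i.+1)%:R - e < Retr (blk M h)].
Proof.
move=> e0; set m := (\sum_(i < M) i.+1)%N.
pose B := G `&` \bigcap_(v in N) [set h | Retr (blk M (v^-1 * h)%g) <= m%:R - e].
have lift A h : G h -> h n = A -> ~ B h ->
    exists h, [/\ G h, h n = A & m%:R - e < Retr (blk M h)].
  move=> Gh hA nB; apply: contrapT => nex; apply: nB; split=> // v [Gv v1] /=.
  rewrite leNgt; apply/negP => hv; apply: nex; exists (v^-1 * h)%g; split=> //.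
    exact: GM (GV Gv) Gh.
  by rewrite coordM coordV v1 invg1 mul1g.
have cB : compact B.
  apply: compact_closedI => //; apply: closed_bigI => v _.
  apply: (@preimage_closed _ _ (fun h => Retr (blk M (v^-1 * h)%g))
    [set r | r <= m%:R - e]); last exact: closed_le.
  by move=> x _; exact: Retr_blk_continuous.
have [B0|/eqP/set0P B0] := pselect (B = set0).
  exists 1 => // A _; have [h Gh hA] := Gsurj A.
  by apply: (lift A h) => //; rewrite B0.
have [|h0 /set_mem Bh0 h0min] := @compact_EVT_min _ R
    (fun h : prodSU R => l1 (su_mx (h n) - 1%:M)) B B0 cB.
  apply: continuous_subspaceT.
  apply: (@coord_continuous_comp R n (fun z => l1 (su_mx z - 1%:M))).
  exact: l1_dist_continuous.
exists (l1 (su_mx (h0 n) - 1%:M)).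
  rewrite lt_def l1_ge0 andbT; apply/eqP => h01.
  have h0n : h0 n = 1%g by apply: su_eqP; rewrite h01.
  have := Bh0.2 h0 (conj Bh0.1 h0n) => /=.
  rewrite mulVg blk1 Retr1; lra.
move=> A Ah0; have [h Gh hA] := Gsurj A; apply: (lift A h) => // Bh.
by have := h0min h (mem_set Bh); rewrite hA leNgt Ah0.
Qed.

Lemma centralizing_lift M : exists2 eta : R, 0 < eta &
  forall A : SU R n.+1, l1 (su_mx A - 1%:M) < eta ->
    exists x, [/\ G x, x n = A &
      forall v, N v -> commute (trunc M x) (trunc M v)].
Proof.
have [|||e e0 central] := @maximal_centralizes R _ _ (@blk R M) (@blkM R M)
  (@blk_unitary R M) N.
- by split.
- by move=> x y [Gx x1] [Gy y1]; split; [exact: GM|rewrite coordM x1 y1 mulg1].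
- by move=> x [Gx x1]; split; [exact: GV|rewrite coordV x1 invg1].
have [delta delta0 close] := @Retr_close_1 R (\sum_(i < M) i.+1) e e0.
have [eta eta0 lift] := lift_near1 M delta0.
exists eta => // A Aeta; have [h [Gh hA hd]] := lift A Aeta.
pose B := G `&` [set x | x n = A].
have cB : compact B by apply: compact_closedI => //; exact: coord_eq_closed.
have [||x /set_mem[Gx xA] xmax] := @compact_EVT_max _ R (fun x => Retr (blk M x)) B _ cB.
- by exists h.
- apply: continuous_subspaceT => x.
  have := @Retr_blk_continuous M 1%g x.
  by under eq_fun do rewrite mul1g.
exists x; split=> // v Nv; rewrite /commute -!truncM; apply: blk_inj.
rewrite !blkM; apply: central Nv.
- move=> u [Gu u1]; apply: xmax; apply/mem_set; split; first exact: GM.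
  by rewrite /= coordM u1 mulg1.
- move=> u [Gu u1]; split; first by apply: GM => //; apply: GM => //; exact: GV.
  by rewrite !coordM coordV u1 mulg1 mulVg.
- apply: close; first exact: blk_unitary.
  by apply: lt_le_trans hd _; apply: xmax; apply/mem_set.
Qed.

Definition has_small_roots (B : SU R n.+1) := forall eta : R, 0 < eta ->
  exists r j, l1 (su_mx r - 1%:M) < eta /\ (r ^+ j)%g = B.

Lemma centralizing_lift_root M (B : SU R n.+1) : has_small_roots B ->
  exists x, [/\ G x, x n = B & forall v, N v -> commute (trunc M x) (trunc M v)].
Proof.
move=> rB; have [eta eta0 lift] := centralizing_lift M.
have [r [j [r1 <-]]] := rB eta eta0; have [x [Gx xr xN]] := lift r r1.
exists (x ^+ j)%g; split; last first.
- move=> v Nv; rewrite truncX; apply/commute_sym/commuteX/commute_sym; exact: xN.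
- by rewrite coordX xr.
by elim: (j) => [|i IHi]; rewrite ?expg0// expgS; exact: GM.
Qed.

Variables t w : SU R n.+1.
Hypotheses (rt : has_small_roots t) (rw : has_small_roots w).
Hypothesis wt : (w * t * w^-1)%g = (t^-1)%g.
Hypothesis t4 : (t ^+ 4)%g = 1%g.

(* For lifts [a], [b] of [t], [w] commuting with [N], the product [b a b^-1 a]
   lies in [N], so [a] commutes with [b a b^-1]; hence the fourth power of
   [b a b^-1 a^-1] is [b a^4 b^-1 a^-4], which is trivial as [a^4] is in [N]. *)
Lemma torsion_lift M : exists s, [/\ G s, s n = (t^-1 * t^-1)%g &
  forall i, (i < M)%N -> (s i ^+ 4)%g = 1%g].
Proof.
have [a [Ga at_ aN]] := centralizing_lift_root M rt.
have [b [Gb bw bN]] := centralizing_lift_root M rw.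
have GX x j : G x -> G (x ^+ j)%g.
  by move=> Gx; elim: j => [|j IHj]; rewrite ?expg0// expgS; exact: GM.
pose p := (b * a * b^-1)%g; have Gp : G p by apply: GM (GM _ _) (GV _).
have pn : p n = (t^-1)%g by rewrite /p !coordM coordV at_ bw.
exists (p * a^-1)%g; split.
- exact: GM (GV Ga).
- by rewrite coordM coordV pn at_.
move=> i iM.
suff /(congr1 (fun x : prodSU R => x i)) : trunc M ((p * a^-1) ^+ 4)%g = 1%g.
  by rewrite /trunc iM coordX.
have Npa : N (p * a)%g by split; [exact: GM|rewrite coordM pn at_ mulVg].
have Na4 : N (a ^+ 4)%g by split; [exact: GX|rewrite coordX at_].
have := aN _ Npa; rewrite truncM => apa.
have ap : commute (trunc M a) (trunc M p).
  have := commuteM apa (commuteV (commute_refl (trunc M a))).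
  by rewrite mulgK.
have := bN _ Na4; rewrite truncX => ba4.
have p4 : (trunc M p ^+ 4)%g = (trunc M a ^+ 4)%g.
  have -> : trunc M p = (trunc M a ^ (trunc M b)^-1)%g.
    by rewrite conjgE invgK /p !truncM truncV mulgA.
  by rewrite -conjXg conjgE invgK mulgA ba4 mulgK.
rewrite truncX truncM truncV expgMn; last exact/commuteV/commute_sym.
by rewrite p4 expVgn mulgV.
Qed.

Lemma torsion_element : exists2 s, G s & s n = (t^-1 * t^-1)%g /\ (s ^+ 4)%g = 1%g.
Proof.
have [s sP] := choice torsion_lift.
have [x [Gx clx]] : G `&` cluster (s @ \oo) !=set0.
  by apply: cG; exists 0%N => // M _; have [] := sP M.
have closed_limit (D : set (prodSU R)) K : closed D ->
    (forall M, (K <= M)%N -> D (s M)) -> D x.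
  move=> cD Ds; apply: cD => V xV.
  have sD : (s @ \oo) D by exists K => // M /= KM; exact: Ds.
  by have [y [Dy Vy]] := clx D V sD xV; exists y.
exists x => //; split.
  apply: (closed_limit [set y : prodSU R | y n = (t^-1 * t^-1)%g] 0%N).
    exact: coord_eq_closed.
  by move=> M _; have [] := sP M.
apply: functional_extensionality_dep => i; rewrite coordX.
apply: (closed_limit [set y : prodSU R | (y i ^+ 4)%g = 1%g] i.+1).
  exact: coord_pow_closed.
by move=> M iM; have [_ _] := sP M; apply.
Qed.

End coordinate_projection_onto_SU.

(** * Elements of finite and of infinite order *)

Section concrete_elements.
Variables (R : realType) (n : nat).
Local Notation C := R[i].
Local Notation J := (block R (ord0 : 'I_n.+1)).

Let JJ : J ^t* *m J = 1%:M. Proof. exact: block_isometry. Qed.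

Lemma SU_emb (A : 'M[C]_2) : is_SU A -> exists x : SU R n.+2, su_mx x = emb J A.
Proof. by move=> SA; apply: is_SU_MkSU; exact (is_SU_emb JJ SA). Qed.

Lemma emb_iter (A : 'M[C]_2) k :
  iter k (mulmx (emb J A)) 1%:M = emb J (iter k (mulmx A) 1%:M).
Proof. by elim: k => [|k IHk]; [rewrite /= emb1|rewrite !iterS IHk (embM JJ)]. Qed.

Lemma one_parameter_small_roots (f : R -> 'M[C]_2) (a : R) (B : SU R n.+2) :
  (forall x, is_SU (f x)) -> (forall x y, f (x + y) = f x *m f y) ->
  (forall x, l1 (f x - 1%:M) <= 2 * (`|cos x - 1| + `|sin x|)) ->
  su_mx B = emb J (f a) -> has_small_roots B.
Proof.
move=> Sf fD f1 Ba eta eta0; pose c : R := l1 J * l1 J + 1.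
have c0 : 0 < c by rewrite ltr_wpDl// mulr_ge0 ?l1_ge0.
pose e := eta / (8 * c); have e0 : 0 < e by rewrite divr_gt0// mulr_gt0.
have /nbhs_ballP[d1 /= d10 hc] : nbhs 0 [set x : R | `|cos x - 1| < e].
  have /cvgrPdist_lt/(_ e e0) := @continuous_cos R 0.
  by apply: filterS => x /=; rewrite cos0; rewrite distrC.
have /nbhs_ballP[d2 /= d20 hs] : nbhs 0 [set x : R | `|sin x| < e].
  have /cvgrPdist_lt/(_ e e0) := @continuous_sin R 0.
  by apply: filterS => x /=; rewrite sin0; rewrite sub0r normrN.
pose d := Num.min d1 d2; have d0 : 0 < d by rewrite lt_min d10.
pose j := (Num.truncn (`|a| / d)).+1.
have j0 : 0 < j%:R :> R by rewrite ltr0n.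
have aj : `|a / j%:R| < d.
  have /andP[_ h] : (Num.truncn (`|a| / d))%:R <= `|a| / d < j%:R.
    by apply: truncn_itv; rewrite divr_ge0// ltW.
  by rewrite normrM normfV (gtr0_norm j0) ltr_pdivrMr// mulrC -ltr_pdivrMr.
have [r rE] := SU_emb (Sf (a / j%:R)).
exists r, j; split.
  rewrite rE -(emb1 J); apply: le_lt_trans (l1_embB _ _ _) _.
  have h1 : `|cos (a / j%:R) - 1| < e.
    apply: hc; rewrite -ball_normE /= sub0r normrN (lt_le_trans aj)//.
    by rewrite ge_min lexx.
  have h2 : `|sin (a / j%:R)| < e.
    apply: hs; rewrite -ball_normE /= sub0r normrN (lt_le_trans aj)//.
    by rewrite ge_min lexx orbT.
  have h3 := f1 (a / j%:R); have l0 := l1_ge0 (f (a / j%:R) - 1%:M).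
  have h4 : l1 (f (a / j%:R) - 1%:M) <= 4 * e by lra.
  have h5 : l1 J * l1 J * l1 (f (a / j%:R) - 1%:M) <= c * (4 * e).
    by rewrite ler_pM ?mulr_ge0 ?l1_ge0// /c lerDl.
  apply: le_lt_trans h5 _.
  rewrite (_ : c * (4 * e) = eta / 2); first lra.
  by rewrite /e; field; rewrite gt_eqF.
apply: val_inj; rewrite /= su_mxX rE Ba emb_iter; congr emb.
have fk k : iter k (mulmx (f (a / j%:R))) 1%:M = f (k%:R * (a / j%:R)).
  elim: k => [|k IHk] /=; last by rewrite IHk -fD -nat1r mulrDl mul1r.
  have f00 : f 0 *m f 0 = f 0 by rewrite -fD addr0.
  have : f 0 *m f 0 *m (f 0) ^t* = f 0 *m (f 0) ^t* by rewrite f00.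
  by rewrite -mulmxA (unitary_mulmxV (Sf 0).1) mulmx1 mul0r => ->.
by rewrite fk mulrCA divff ?mulr1// gt_eqF.
Qed.

Lemma quaternion_pair : exists t w : SU R n.+2,
  [/\ has_small_roots t, has_small_roots w, (w * t * w^-1)%g = (t^-1)%g,
    (t ^+ 4)%g = 1%g & (t^-1 * t^-1)%g <> 1%g].
Proof.
pose f1 (x : R) : 'M[C]_2 := quat (cos x +i* sin x)%C 0.
pose f2 (x : R) : 'M[C]_2 := quat (cos x)%:C%C (sin x)%:C%C.
have Sf1 x : is_SU (f1 x).
  apply: is_SU_quat; rewrite mul0r addr0 -normCK -add_Re2_Im2 /= cos2Dsin2.
  by [].
have Sf2 x : is_SU (f2 x).
  by apply: is_SU_quat; rewrite !conjC_real -!rmorphM -rmorphD /= -!expr2 cos2Dsin2.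
have f1D x y : f1 (x + y) = f1 x *m f1 y.
  rewrite /f1 quatM conjC0 !mulr0 mul0r subr0 addr0; congr quat.
  by apply/eqP; rewrite eq_complex /= cosD sinD; apply/andP;
    split; apply/eqP; ring.
have f2D x y : f2 (x + y) = f2 x *m f2 y.
  rewrite /f2 quatM !conjC_real -!rmorphM -rmorphB -rmorphD /= cosD sinD.
  by rewrite [X in _ = quat _ X%:C%C]addrC.
have f1b x : l1 (f1 x - 1%:M) <= 2 * (`|cos x - 1| + `|sin x|).
  rewrite -quat10 l1_quatB subrr cabs0 mulr0 addr0 ler_wpM2l//.
  by apply: le_trans (cabs_le_ReIm _) _; rewrite /= oppr0 addr0.
have f2b x : l1 (f2 x - 1%:M) <= 2 * (`|cos x - 1| + `|sin x|).
  by rewrite -quat10 l1_quatB subr0 -rmorphB !cabs_real mulrDr.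
have [t tE] := SU_emb (Sf1 (pi / 2)); have [w wE] := SU_emb (Sf2 (pi / 2)).
have tq : f1 (pi / 2) = quat (0 +i* 1)%C 0 by rewrite /f1 cos_pihalf sin_pihalf.
have wq : f2 (pi / 2) = quat 0 1 by rewrite /f2 cos_pihalf sin_pihalf.
have tt : su_mx (t * t)%g = emb J (quat (-1) 0).
  rewrite -[LHS]/(su_mx t *m su_mx t) tE -(embM JJ) tq quatM; congr emb.
  by apply: quat_eq; rewrite ?conjC0 ?mulr0 ?mul0r ?addr0// subr0;
    apply/eqP; rewrite eq_complex /=; apply/andP; split; apply/eqP; ring.
have tN1 : (t * t)%g <> 1%g.
  move=> /(congr1 (@su_mx R n.+2)); rewrite tt => /esym; rewrite -[LHS](emb1 J).
  move=> /(emb_inj JJ)/matrixP/(_ 0 0); rewrite -quat10 !mxE /= => /eqP.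
  by rewrite -subr_eq0 opprK -mulr2n pnatr_eq0.
exists t, w; split.
- exact: (one_parameter_small_roots Sf1 f1D f1b tE).
- exact: (one_parameter_small_roots Sf2 f2D f2b wE).
- apply: (mulIg w); rewrite mulgVK; apply: val_inj.
  rewrite -[LHS]/(su_mx w *m su_mx t) -[RHS]/((su_mx t) ^t* *m su_mx w).
  rewrite tE wE emb_trC -!(embM JJ) tq wq quat_trC !quatM; congr emb.
  by apply: quat_eq; apply/eqP; rewrite eq_complex /=; apply/andP; split; apply/eqP; ring.
- have -> : (t ^+ 4 = (t * t) * (t * t))%g by rewrite !expgS expg0 mulg1 !mulgA.
  apply: val_inj; rewrite -[LHS]/(su_mx (t * t)%g *m su_mx (t * t)%g) tt -(embM JJ).
  rewrite quatM -[RHS](emb1 J) -quat10; congr emb.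
  by apply: quat_eq; rewrite ?conjC0; ring.
- by rewrite -invgM => /eqP; rewrite invg_eq1 => /eqP.
Qed.

(* [(3 + 4i)^k] is congruent to [3 + 4i] modulo 5, so it is never real. *)
Lemma infinite_order_SU : exists A : SU R n.+2, ~ finite_order A.
Proof.
pose q : 'M[C]_2 := quat (3 / 5 : R)%:C%C (4 / 5 : R)%:C%C.
have Sq : is_SU q.
  apply: is_SU_quat; rewrite !conjC_real -!rmorphM -rmorphD /=.
  by rewrite (_ : _ + _ = 1)//; field.
have [A AE] := SU_emb Sq; exists A => -[[//|k] _].
move=> /(congr1 (@su_mx R n.+2)); rewrite su_mxX AE emb_iter.
rewrite -[RHS](emb1 J) => /(emb_inj JJ).
have [u [v ->]] : exists u v : int, iter k.+1 (mulmx q) 1%:M =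
    quat ((3 + 5 * u)%:~R / 5 ^+ k.+1 : R)%:C%C ((4 + 5 * v)%:~R / 5 ^+ k.+1 : R)%:C%C.
  elim: k => [|k [u [v IHk]]].
    by exists 0, 0; rewrite /= mulmx1 !mulr0 !addr0 expr1.
  exists (3 * u - 4 * v - 2), (3 * v + 4 * u + 4).
  rewrite iterS IHk quatM !conjC_real -!rmorphM -rmorphB -rmorphD /=.
  have p5 : (5 ^+ k.+1 : R) != 0 by rewrite expf_neq0.
  by apply: quat_eq; congr (_%:C%C);
    rewrite !(rmorphD, rmorphN, rmorphM) /= [5 ^+ k.+2]exprS; field.
rewrite -quat10 => /matrixP/(_ 0 1); rewrite !mxE /= => /complexI /eqP.
rewrite mulf_eq0 invr_eq0 expf_eq0 /= pnatr_eq0 orbF intr_eq0 => /eqP v0.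
have : (4 + 5 * v = 0 :> int)%R by exact: v0.
lia.
Qed.

End concrete_elements.

(** * The space of compact subgroups *)

Section generic_subgroups.
Variables (R : realType) (d : forall n, biinvariant_metric R n.+1).

Lemma compact_subgroup1 (G : compact_subgroup R) : csg_set G 1%g.
Proof. exact: set_mem (csg_group G).1. Qed.

Lemma compact_subgroup_div (G : compact_subgroup R) x y :
  csg_set G x -> csg_set G y -> csg_set G (x * y^-1)%g.
Proof.
move=> Gx Gy; apply: set_mem.
by apply: (csg_group G).2; exact: mem_set.
Qed.

Lemma compact_subgroupV (G : compact_subgroup R) x :
  csg_set G x -> csg_set G (x^-1)%g.
Proof.
by move=> Gx; have := compact_subgroup_div (compact_subgroup1 G) Gx; rewrite mul1g.
Qed.

Lemma compact_subgroupM (G : compact_subgroup R) x y :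
  csg_set G x -> csg_set G y -> csg_set G (x * y)%g.
Proof.
move=> Gx Gy; rewrite -[y]invgK; apply: compact_subgroup_div => //.
exact: compact_subgroupV.
Qed.

Definition coord_onto n : set (subgroup_space d) :=
  [set G | forall A : SU R n.+1, exists2 g, csg_set G g & g n = A].

Lemma coord_onto_finite_infinite_order n (G : subgroup_space d) : coord_onto n.+1 G ->
  (exists g : prodSU R, [/\ csg_set G g, g <> 1%g & finite_order g]) /\
  (exists g : prodSU R, csg_set G g /\ ~ finite_order g).
Proof.
move=> onto; split.
  have [t [w [rt rw wt t4 tt]]] := @quaternion_pair R n.
  have [s Gs [sn s4]] := torsion_element (@csg_compact _ G) (compact_subgroup1 G)
    (@compact_subgroupM G) (@compact_subgroupV G) onto rt rw wt t4.
  exists s; split=> //; last by exists 4%N.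
  by move=> s1; apply: tt; rewrite -sn s1.
have [A Ainf] := @infinite_order_SU R n; have [g Gg gA] := onto A.
exists g; split=> // -[k k0 gk]; apply: Ainf; exists k => //.
rewrite -gA; have -> : (g n.+1 ^+ k = (g ^+ k) n.+1)%g.
  elim: (k) => [|j IHj]; first by rewrite !expg0.
  by rewrite !expgS IHj.
by rewrite gk.
Qed.

(* [pi_N(G) x prod_(i >= N) SU(i+1)] *)
Definition thicken_set (N : nat) (G : set (prodSU R)) : set (prodSU R) :=
  [set x | exists2 g, G g & forall i, (i < N)%N -> x i = g i].

Lemma thicken_compact N (G : set (prodSU R)) : compact G -> compact (thicken_set N G).
Proof.
move=> cG.
pose f (gy : prodSU R * prodSU R) : prodSU R :=
  fun i => if (i < N)%N then gy.1 i else gy.2 i.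
have -> : thicken_set N G = f @` (G `*` setT).
  apply/seteqP; split=> [x [g Gg xg]|_ [[g y] [Gg _] <-]]; last first.
    by exists g => // i iN; rewrite /f iN.
  exists (g, x) => //; apply: functional_extensionality_dep => i; rewrite /f /=.
  by case: ifP => // iN; rewrite xg.
apply: continuous_compact; last exact: compact_setX cG (@prodSU_compact R).
apply: continuous_subspaceT => -[g y].
apply/cvg_sup => i V [W [[U oU <-] Ugy UV]].
suff : nbhs (g, y) [set gy : prodSU R * prodSU R | U (f gy i)].
  by apply: filterS => gy; exact: UV.
move: Ugy; rewrite /f /=; case: (i < N)%N => Ugy.
- exists ([set z : prodSU R | U (z i)], setT); last by move=> [a b] [].
  split; last exact: filterT.
  apply: (@proj_continuous nat (fun n => SU R n.+1) i g).
  exact: open_nbhs_nbhs.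
- exists (setT, [set z : prodSU R | U (z i)]); last by move=> [a b] [].
  split; first exact: filterT.
  apply: (@proj_continuous nat (fun n => SU R n.+1) i y).
  exact: open_nbhs_nbhs.
Qed.

Lemma thicken_group N (G : compact_subgroup R) :
  group_closed (mem (thicken_set N (csg_set G))).
Proof.
split; first by apply/mem_set; exists 1%g => //; exact: compact_subgroup1.
move=> x y /set_mem[g Gg xg] /set_mem[h Gh yh]; apply/mem_set.
exists (g * h^-1)%g; first exact: compact_subgroup_div.
move=> i iN; rewrite -[LHS]/(x i * (y i)^-1)%g -[RHS]/(g i * (h i)^-1)%g.
by rewrite xg// yh.
Qed.

Definition thicken N (G : compact_subgroup R) : compact_subgroup R :=
  CompactSubgroup (thicken_compact (N := N) (@csg_compact _ G)) (thicken_group N G).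

Lemma prod_dist_tail N (x y : prodSU R) : (forall i, (i < N)%N -> x i = y i) ->
  prod_dist d x y <= 2 ^- N.
Proof.
move=> xy; apply: limr_le; first exact: is_cvg_prod_dist.
suff h j : series (fun n => 2 ^- n.+1 * d n (x n) (y n)) (N + j)%N
    <= 2 ^- N - 2 ^- (N + j).
  exists N => // k /= Nk; rewrite -(subnKC Nk); apply: le_trans (h _) _.
  by rewrite gerBl invr_ge0 exprn_ge0.
elim: j => [|j IHj].
  rewrite addn0 subrr /series /= big_nat big1// => i /andP[_ iN].
  by rewrite xy// bdistxx mulr0.
have half : (2 ^- (N + j) : R) = 2 * 2 ^- (N + j).+1.
  by rewrite exprS invfM mulrA divff ?mul1r.
have last_le : 2 ^- (N + j).+1 * d (N + j)%N (x (N + j)%N) (y (N + j)%N)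
    <= 2 ^- (N + j).+1.
  by rewrite ler_piMr ?bdist_le1// invr_ge0 exprn_ge0.
rewrite addnS seriesSr; move: last_le IHj; rewrite half => *; lra.
Qed.

Lemma thicken_dist N (G : subgroup_space d) :
  subgroup_dist G (thicken N G : subgroup_space d) <= 2 ^- N.
Proof.
have N0 : 0 <= 2 ^- N :> R by rewrite invr_ge0 exprn_ge0.
have ne (H : compact_subgroup R) : (csg_set H !=set0) by exact: csg_nonempty.
rewrite /subgroup_dist /hausdorff_dist ge_max; apply/andP; split.
  apply: (excess_le (ne G)) => g Gg; have Tg : csg_set (thicken N G) g by exists g.
  apply: le_trans (point_set_dist_le (@prod_dist_ge0 R d) g Tg) _.
  by rewrite prod_distxx.
apply: (excess_le (ne (thicken N G))) => x [g Gg xg].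
apply: le_trans (point_set_dist_le (@prod_dist_ge0 R d) x Gg) _.
exact: prod_dist_tail.
Qed.

Lemma excess_approx (A B : set (prodSU R)) x e : B !=set0 -> A x ->
  excess (prod_dist d) A B < e -> exists2 y, B y & prod_dist d x y < e.
Proof.
move=> B0 Ax ABe.
have inf_xB : has_inf [set prod_dist d x b | b in B].
  split; first by have [b Bb] := B0; exists (prod_dist d x b), b.
  by exists 0 => _ [b _ <-]; exact: prod_dist_ge0.
have h : point_set_dist (prod_dist d) x B < e.
  apply: le_lt_trans ABe; apply: excess_ge => //.
  - exact: prod_dist_ge0.
  - exact: prod_dist_le1.
have e0 : 0 < e - point_set_dist (prod_dist d) x B by rewrite subr_gt0.
have [_ [b Bb <-] be] := inf_adherent e0 inf_xB.
by exists b => //; rewrite addrC subrK in be.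
Qed.

Lemma near_onto_interior N (G : subgroup_space d) :
  coord_onto N G -> interior (coord_onto N) G.
Proof.
move=> onto; have [r0 r00 rigid] := @dense_in_SU_approx R N.
pose k : R := (N.+1 * N.+1)%:R.
have k0 : 0 < k by rewrite ltr0n muln_gt0.
have : nbhs (1%g : SU R N.+1) [set y | l1 (su_mx y - 1%:M) < r0 / k].
  by apply/SU_nbhs; exists (r0 / k); rewrite ?divr_gt0.
move=> /(bdist_nbhs (d N))[e e0 eP].
have e'0 : 0 < 2 ^- N.+1 * e by rewrite mulr_gt0// invr_gt0 exprn_gt0.
apply/nbhs_ballP; exists (2 ^- N.+1 * e) => // H GH.
have {}GH : subgroup_dist G H < 2 ^- N.+1 * e by exact: GH.
have exGH : excess (prod_dist d) (csg_set G) (csg_set H) < 2 ^- N.+1 * e.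
  by apply: le_lt_trans GH; rewrite /subgroup_dist /hausdorff_dist le_max lexx.
pose Q : set 'M[R[i]]_N.+1 := [set su_mx (h N) | h in csg_set H].
have QG : SU_subgroup Q.
  split.
  - by exists 1%g => //; exact: compact_subgroup1.
  - by move=> _ [h _ <-]; exact: is_SU_val.
  - move=> _ _ [h Hh <-] [h' Hh' <-]; exists (h * h')%g => //.
    exact: compact_subgroupM.
  - by move=> _ [h Hh <-]; exists (h^-1)%g => //; exact: compact_subgroupV.
have Qd : dense_in_SU Q r0.
  move=> A SA; have [a aA] := is_SU_MkSU SA; have [x Gx xa] := onto a.
  have [h Hh xh] := excess_approx (csg_nonempty H) Gx exGH.
  exists (su_mx (h N)); first by exists h.
  have := le_lt_trans (prod_dist_ge d x h N) xh.
  rewrite ltr_pM2l ?invr_gt0 ?exprn_gt0// -(bdist_mull (d N) (x N)^-1%g) mulVg.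
  move=> /eP /= h1; rewrite -aA -xa.
  have -> : su_mx (x N) - su_mx (h N) =
      - (su_mx (x N) *m (su_mx ((x N)^-1 * h N)%g - 1%:M)).
    rewrite mulmxBr mulmx1 -[X in _ = - (X - _)]/(su_mx (x N * ((x N)^-1 * h N))%g).
    by rewrite mulVKg opprB.
  rewrite l1N; apply: le_trans (l1_unitaryMl _ (is_SU_val (x N)).1) _.
  by rewrite -ler_pdivlMl// mulrC ltW.
move=> A.
have [|h0 /set_mem Hh0 h0min] := @compact_EVT_min _ R
    (fun h : prodSU R => l1 (su_mx (h N) - su_mx A)) (csg_set H) (csg_nonempty H)
    (@csg_compact _ H).
  apply: continuous_subspaceT.
  apply: (@coord_continuous_comp R N (fun z => l1 (su_mx z - su_mx A))).
  exact: l1_dist_continuous.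
exists h0 => //; apply: su_eqP; rewrite leNgt; apply/negP => p.
have [|_ [h Hh <-] hA] := rigid Q QG Qd (l1 (su_mx (h0 N) - su_mx A) / 2) _
  (su_mx A) (is_SU_val A); first by rewrite divr_gt0.
have := h0min h (mem_set Hh); rewrite l1BC in hA; lra.
Qed.

End generic_subgroups.

Theorem theorem5p27 (R : realType) (d : forall n, biinvariant_metric R n.+1) :
  comeager [set G : subgroup_space d |
    (exists g : prodSU R, [/\ csg_set G g, g <> 1%g & finite_order g]) /\
    (exists g : prodSU R, csg_set G g /\ ~ finite_order g)].
Proof.
pose O : set (subgroup_space d) := \bigcup_n interior (@coord_onto R d n.+1).
exists O; last by move=> G [n _ /interior_subset]; exact: coord_onto_finite_infinite_order.
exists (fun=> O); last by rewrite bigcap_const.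
move=> _; split; first by apply: bigcup_open => n _; exact: open_interior.
move=> U [G UG] oU.
have /nbhs_ballP[e /= e0 eU] : nbhs G U by exact: open_nbhs_nbhs.
pose N := (Num.truncn e^-1).+1.
have Ne : 2 ^- N < e.
  rewrite invf_plt ?posrE ?exprn_gt0//.
  have /andP[_ h] : (Num.truncn e^-1)%:R <= e^-1 < N%:R.
    by apply: truncn_itv; rewrite invr_ge0 ltW.
  by apply: lt_trans h _; rewrite -natrX ltr_nat ltn_expl.
exists (thicken N G : subgroup_space d); split.
  by apply: eU; apply: le_lt_trans Ne; exact: thicken_dist.
exists (Num.truncn e^-1) => //; apply: near_onto_interior => A.
exists (dfwith (1%g : prodSU R) N A); last by rewrite dfwithin.
exists 1%g; first exact: compact_subgroup1.
by move=> i iN; rewrite dfwithout// gtn_eqF.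
Qed.
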